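(* There is a function $F:[0,1]\rightarrow 2^{[0,1]}$ such that $F$ is upper semicontinuous, surjective, and light, has the intermediate value property, and has, for every $n\in\mathbb{N}$, an orbit of period $n$, and such that the graph $G(F)$ has empty interior (in $[0,1]^2$), yet the inverse limit $\varprojlim\{[0,1],F\}$ is an arcwise connected, hereditarily decomposable tree-like continuum.
   Context: $\omega=\{0,1,2,\dots\}$ and $\mathbb{N}=\{1,2,\dots\}$. A continuum is a nonempty, compact, connected metric space. For a compact metric space $X$, $2^X$ denotes the collection of nonempty compact subsets of $X$. Let $F:[0,1]\to 2^{[0,1]}$. Its graph is $G(F)=\{(x,y)\in[0,1]^2: y\in F(x)\}$. $F$ is upper semicontinuous if for every $x$ and every open set $U\supseteq F(x)$ there is an open set $V\ni x$ (open in the domain) such that $F(y)\subseteq U$ for all $y\in V$. $F$ is surjective if for every $y\in[0,1]$ there is $x\in[0,1]$ with $y\in F(x)$. $F$ is light if for every $y\in[0,1]$ the set $\{x\in[0,1]: y\in F(x)\}$ has empty interior. $F$ has the intermediate value property if, given distinct $x_1,x_2$ and distinct $y_1\in F(x_1)$, $y_2\in F(x_2)$, for every $y$ strictly between $y_1$ and $y_2$ there is some $x$ strictly between $x_1$ and $x_2$ with $y\in F(x)$. An orbit of $F$ is a sequence $\{x_i\}_{i\in\omega}$ with $x_{i+1}\in F(x_i)$ for all $i$. It is periodic if there is $n\in\mathbb{N}$ with $x_{n+i}=x_i$ for all $i$; the smallest such $n$ is the period of the orbit. The inverse limit is $\varprojlim\{[0,1],F\}=\{(x_0,x_1,\dots)\in[0,1]^{\omega}: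 x_{i-1}\in F(x_i)\text{ for all } i\ge 1\}$, with the subspace topology from the product. A nondegenerate continuum is decomposable if it is the union of two proper subcontinua; a continuum is hereditarily decomposable if each of its nondegenerate subcontinua is decomposable. A tree is a uniquely arcwise connected union of finitely many arcs. A continuum is tree-like if it is homeomorphic to an inverse limit (with continuous single-valued bonding maps) on trees. *)

(* Defs.v *)
(* Subspaces are represented by [set_type A], which carries the subspace
   topology. *)
From mathcomp Require Import all_boot all_order all_algebra.
From mathcomp Require Import all_classical all_reals all_analysis.

Set Implicit Arguments.
Unset Strict Implicit.
Unset Printing Implicit Defensive.

Import Order.TTheory GRing.Theory Num.Theory.
Import numFieldNormedType.Exports.

Local Open Scope classical_set_scope.
Local Open Scope ring_scope.

Definition unit_interval (R : realType) : set R := `[0, 1].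
Arguments unit_interval : clear implicits.

Definition homeomorphism (X Y : topologicalType) (f : X -> Y) : Prop :=
  continuous f /\
  exists g : Y -> X, [/\ continuous g, cancel f g & cancel g f].

Definition homeomorphic (X Y : topologicalType) : Prop :=
  exists f : X -> Y, homeomorphism f.

Definition metrizable (R : realType) (X : topologicalType) : Prop :=
  exists M : metricType R, homeomorphic X M.

(* The realType R is where distances take their values and where the model
   arc [0, 1] lives. *)
Section Continua.
Variables (R : realType) (X : topologicalType).
Implicit Types A B C : set X.

Definition continuum A : Prop :=
  [/\ A !=set0, compact A, connected A & metrizable R (set_type A)].

Definition nondegenerate A : Prop := exists x y, [/\ A x, A y & x <> y].

Definition decomposable A : Prop :=
  exists B C, [/\ continuum B, continuum C, B `<` A, C `<` A & B `|` C = A].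

Definition hereditarily_decomposable A : Prop :=
  forall B, B `<=` A -> continuum B -> nondegenerate B -> decomposable B.

Definition arc A : Prop :=
  homeomorphic (set_type (unit_interval R)) (set_type A).

Definition arc_between A (x y : X) : Prop :=
  exists f : unit_interval R -> set_type A,
    [/\ homeomorphism f,
        forall t, set_val t = 0 -> set_val (f t) = x &
        forall t, set_val t = 1 -> set_val (f t) = y].

Definition arcwise_connected A : Prop :=
  forall x y, A x -> A y -> x <> y ->
    exists2 B, B `<=` A & arc_between B x y.

Definition uniquely_arcwise_connected A : Prop :=
  forall x y, A x -> A y -> x <> y ->
    exists! B, B `<=` A /\ arc_between B x y.

Definition tree A : Prop :=
  [/\ continuum A,
      uniquely_arcwise_connected A &
      exists (n : nat) (B : 'I_n -> set X),
        (forall i, arc (B i)) /\ \bigcup_i B i = A].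

End Continua.

(* Bonding maps are set-valued; a single-valued map f is seen as
   x |-> [set f x]. *)
Definition inverse_limit (T : nat -> topologicalType)
    (F : forall n, T n.+1 -> set (T n)) : set (prod_topology T) :=
  [set x | forall n, F n (x n.+1) (x n)].

Definition tree_like (R : realType) (X : topologicalType) (A : set X) : Prop :=
  exists (T : nat -> topologicalType) (f : forall n, T n.+1 -> T n),
    [/\ forall n, tree R [set: T n],
        forall n, continuous (f n) &
        homeomorphic (set_type A)
          (set_type (inverse_limit (fun n x => [set f n x])))].

Section SetValuedFunctions.
Variables (R : realType) (F : unit_interval R -> set (unit_interval R)).

Definition compact_valued : Prop := forall x, F x !=set0 /\ compact (F x).

Definition graph : set (unit_interval R * unit_interval R) :=
  [set p | F p.1 p.2].

Definition upper_semicontinuous : Prop :=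
  forall x (U : set (unit_interval R)), open U -> F x `<=` U ->
    exists V : set (unit_interval R),
      [/\ open V, V x & forall y, V y -> F y `<=` U].

Definition surjective_multimap : Prop := forall y, exists x, F x y.

Definition light : Prop := forall y, interior [set x | F x y] = set0.

Definition strictly_between (a b c : R) : Prop := a < b < c \/ c < b < a.

Definition intermediate_value_property : Prop :=
  forall x1 x2 y1 y2, x1 <> x2 -> y1 <> y2 -> F x1 y1 -> F x2 y2 ->
    forall y, strictly_between (set_val y1) (set_val y) (set_val y2) ->
      exists2 x, strictly_between (set_val x1) (set_val x) (set_val x2) & F x y.

Definition multimap_orbit (x : nat -> unit_interval R) : Prop :=
  forall i, F (x i) (x i.+1).

End SetValuedFunctions.

Definition has_period (T : Type) (x : nat -> T) (n : nat) : Prop :=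
  [/\ (0 < n)%N,
      forall i, x (n + i)%N = x i &
      forall m, (0 < m)%N -> (forall i, x (m + i)%N = x i) -> (n <= m)%N].

(* Main.v *)
Require Import Defs.
From HB Require Import structures.
From mathcomp Require Import all_boot all_order all_algebra.
From mathcomp Require Import all_classical all_reals all_analysis.
From mathcomp Require Import ring lra zify.

(** The set-valued map sends a to the point a / 3 and to a vertical hair of
    values above a / 3. The length of the hair measures how badly a is
    approximated by triadic rationals ([hair]). Triadic rationals carry no hair,
    so the map is single-valued on a dense set; this makes it light and gives
    the graph empty interior. The approximation is tested only at the scales
    3^(-k^2), which are so far apart that a translation by 3^(-N^2) changes the
    length of a hair by at most 4 * 3^(-N) ([hair_shift]). So every hair is
    approached by hairs of almost the same length from both sides, which yields
    the intermediate value property. The hair over 1/4 reaches up to 1, and 3/4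
    is mapped to 1/4; so there are orbits of all periods.

    After rescaling the coordinate i by 3^(-i), a point of the inverse limit is
    a nonincreasing sequence u which may drop only where there is a hair. The
    limit is closed under truncation, which replaces all u i by min (u i) s. The
    truncations of u form an arc that joins it to the zero sequence and is
    parametrized by the height u 0; two such arcs coincide up to some level and
    are disjoint above it. Hence the limit is arcwise connected
    ([truncation_system_arcwise_connected]).

    A triadic coordinate u i forces u 0 = u i, because the sequence cannot drop
    onto a triadic value ([scaled_on_grid]). Therefore it is continuous on the
    limit to round the coordinates up to multiples of 3^(-M) and to truncate the
    result at the height u 0 ([rounded_continuous]). There are finitely many
    rounded sequences, so the image is a finite union of arcs, and it is a tree:
    each of its points separates what lies above it from the rest
    ([grid_locally_constant]). Rounding to a finer grid first does not change
    the result, and the error is at most 3^(-M). So the limit is the inverse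
    limit of these trees, with rounding as bonding maps.

    The same cut points, pulled back to the limit, show that a subcontinuum
    contains the arc between any two of its points
    ([continuum_contains_cuts]). It has a lowest point, and cutting it at a
    higher level decomposes it
    ([tree_approximations_hereditarily_decomposable]). *)

Set Implicit Arguments.
Unset Strict Implicit.
Unset Printing Implicit Defensive.

Import Order.TTheory GRing.Theory Num.Theory.
Import numFieldNormedType.Exports.

Local Open Scope classical_set_scope.
Local Open Scope ring_scope.

(** * Continuity and compactness *)

Section ContinuityCriteria.

Lemma closed_le_fun (R : realType) (X : topologicalType) (f g : X -> R) :
  continuous f -> continuous g -> closed [set x | f x <= g x].
Proof.
move=> cf cg; have -> : [set x | f x <= g x] = (g \- f) @^-1` [set y | 0 <= y].
  by apply/seteqP; split => x /=; rewrite subr_ge0.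
apply: (iffLR (continuous_closedP (g \- f)) _); last exact: closed_ge.
by move=> x; apply: cvgB; [exact: cg|exact: cf].
Qed.

Lemma continuous_min_fun (R : realType) (X : topologicalType) (f g : X -> R) :
  continuous f -> continuous g -> continuous (fun x => Num.min (f x) (g x)).
Proof.
move=> cf cg x; rewrite /continuous_at minr_absE.
under eq_fun do rewrite minr_absE.
apply: cvgMl; apply: cvgB.
  by apply: cvgD; [exact: cf|exact: cg].
by apply: cvg_norm; apply: cvgB; [exact: cf|exact: cg].
Qed.

Lemma continuous_max_fun (R : realType) (X : topologicalType) (f g : X -> R) :
  continuous f -> continuous g -> continuous (fun x => Num.max (f x) (g x)).
Proof.
move=> cf cg x; rewrite /continuous_at maxr_absE.
under eq_fun do rewrite maxr_absE.
apply: cvgMl; apply: cvgD.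
  by apply: cvgD; [exact: cf|exact: cg].
by apply: cvg_norm; apply: cvgB; [exact: cf|exact: cg].
Qed.

Lemma continuous_to_prod (I : Type) (K : I -> topologicalType)
    (Z : topologicalType) (g : Z -> prod_topology K) :
  (forall i, continuous (fun z => g z i)) -> continuous g.
Proof.
move=> gi z; apply/cvg_sup => i U [B [[V oV <-] /= Oz] OU].
apply: filterS OU _; apply: (gi i z); exact: open_nbhs_nbhs.
Qed.

Lemma continuous_prod_coord (I : eqType) (K : I -> topologicalType) (i : I) :
  continuous (fun x : prod_topology K => x i).
Proof. exact: proj_continuous. Qed.

Lemma continuous_to_set_type (X Z : topologicalType) (A : set X)
    (g : Z -> set_type A) :
  continuous (fun z => set_val (g z)) -> continuous g.
Proof.
move=> cg z U [B [[V oV <-] /= Oz] OU].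
apply: filterS OU _; apply: (cg z); exact: open_nbhs_nbhs.
Qed.

Lemma continuous_set_val (X : topologicalType) (A : set X) :
  continuous (@set_val X A).
Proof. exact: initial_continuous. Qed.

Lemma set_val_inj (X : Type) (A : set X) : injective (@set_val X A).
Proof. by move=> x y; exact: val_inj. Qed.

Lemma hausdorff_set_type (X : topologicalType) (A : set X) :
  hausdorff_space X -> hausdorff_space (set_type A).
Proof.
move=> hX x y xy; apply: set_val_inj; apply: hX => U V Ux Vy.
have [z [Uz Vz]] := xy _ _ (@continuous_set_val X A x _ Ux)
  (@continuous_set_val X A y _ Vy).
by exists (set_val z).
Qed.

(** Continuity into a compact set can be tested after a continuous injection h
    into a Hausdorff space: a limit point of the values of g near z has the
    h-value of g z, hence is g z. *)
Lemma continuous_through_compact (X Y Z : topologicalType) (A : set X)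
    (h : X -> Y) (g : Z -> X) :
  compact A -> hausdorff_space Y -> continuous h ->
  (forall x y, A x -> A y -> h x = h y -> x = y) ->
  (forall z, A (g z)) -> continuous (h \o g) -> continuous g.
Proof.
move=> cA hY ch ih Ag chg z U; rewrite nbhsE => -[D [oD Dgz] DU].
apply: filterS DU _; apply: contrapT => nD.
pose F := filter_from (nbhs z) (fun V => (g @` V) `\` D).
have FF : ProperFilter F.
  apply: filter_from_proper; last first.
    move=> V Vz; apply: contrapT => /nonemptyPn e; apply: nD.
    apply: filterS Vz => w Vw; apply: contrapT => nDw.
    have : ((g @` V) `\` D) (g w) by split => //; exists w.
    by rewrite e.
  apply: filter_from_filter; first by exists setT; exact: filterT.
  move=> V W Vz Wz; exists (V `&` W); first exact: filterI.
  by move=> _ [[w [Vw Ww] <-] nDw]; split; split => //; exists w.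
have [x [Ax Fx]] : A `&` cluster F !=set0.
  by apply: cA; exists setT; [exact: filterT|move=> _ [[w _ <-] _]].
have nDx : ~ D x.
  move=> Dx; have [||w [[_ nw] Dw]] := Fx ((g @` setT) `\` D) D.
  - by exists setT => //; exact: filterT.
  - exact: open_nbhs_nbhs.
  - exact: nw.
apply: nDx; suff -> : x = g z by [].
apply: ih => //; apply: hY => V W Vx Wz.
have [|w [[[v Wv <-] _] Vv]] :=
    Fx ((g @` ((h \o g) @^-1` W)) `\` D) _ _ (ch x _ Vx).
  by exists ((h \o g) @^-1` W) => //; exact: (chg z).
by exists (h (g v)).
Qed.

Lemma compact_hausdorff_homeomorphism (X Y : topologicalType) (f : X -> Y) :
  compact [set: X] -> hausdorff_space Y -> continuous f -> injective f ->
  (forall y, exists x, f x = y) -> homeomorphism f.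
Proof.
move=> cX hY cf fi fs; split => //.
have [g gf] := boolp.choice fs.
exists g; split => //.
- apply: (continuous_through_compact cX hY cf _ (g := g)) => //.
    by move=> x y _ _; exact: fi.
  have -> : f \o g = id by apply/funext => y; exact: gf.
  by move=> y; exact: cvg_id.
- by move=> x; apply: fi.
Qed.

(** A continuous surjection from a compact space onto a Hausdorff space is
    closed, hence a quotient map. *)
Lemma continuous_of_compact_quotient (X Y Z : topologicalType) (p : X -> Y)
    (f : Y -> Z) :
  compact [set: X] -> hausdorff_space Y -> continuous p ->
  (forall y, exists x, p x = y) -> continuous (f \o p) -> continuous f.
Proof.
move=> cX hY cp sp cfp; apply/continuous_closedP => C cC.
have -> : f @^-1` C = p @` ((f \o p) @^-1` C).
  apply/seteqP; split=> [y Cy|_ [x Cx <-]//].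
  by have [x xy] := sp y; exists x => //=; rewrite xy.
apply: compact_closed => //; apply: continuous_compact.
  exact: continuous_subspaceT.
rewrite -(setTI (_ @^-1` _)); apply: compact_closedI => //.
exact: (iffLR (continuous_closedP _) cfp).
Qed.

Lemma compact_set_typeT (X : topologicalType) (A : set X) :
  compact A -> compact [set: set_type A].
Proof.
move=> cA F FF _.
pose G := (@set_val X A) @ F.
have [x [Ax Gx]] : A `&` cluster G !=set0.
  by apply: cA; rewrite /G /=; apply: filterS filterT => x _; exact: set_valP.
exists (exist _ x (mem_set Ax)); split => // U V FU [B [[W oW <-] /= Wx] WV].
have [||_ [[y Uy <-] Wy]] := Gx (set_val @` U) W.
- by rewrite /G/=; apply: filterS FU => y Uy; exists y.
- exact: open_nbhs_nbhs.
by exists y; split => //; exact: WV.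
Qed.

End ContinuityCriteria.

(** * Connectedness *)

Section Connectedness.

(** P cuts out a relatively clopen part of K. *)
Lemma connected_local_invariant (X : topologicalType) (K : set X)
    (P : X -> Prop) (x y : X) :
  connected K ->
  (forall q, K q -> P q -> \forall q' \near q, K q' -> P q') ->
  (forall q, K q -> ~ P q -> \forall q' \near q, K q' -> ~ P q') ->
  K x -> K y -> P x -> P y.
Proof.
move=> cK op cl Kx Ky Px.
suff : K `&` P = K by move=> KP; have := Ky; rewrite -KP => -[].
apply: cK; first by exists x.
- exists (interior [set q' | K q' -> P q']); first exact: open_interior.
  apply/seteqP; split => q [Kq Pq]; split => //; first exact: op.
  by have := interior_subset Pq; apply.
- exists (~` interior [set q' | K q' -> ~ P q']).
    by apply: open_closedC; exact: open_interior.
  apply/seteqP; split => q [Kq Pq]; split => //.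
    by move=> /interior_subset /(_ Kq).
  by apply: contrapT => nP; apply: Pq; exact: cl.
Qed.

Lemma connected_image (X Y : topologicalType) (f : X -> Y) (A : set X) :
  continuous f -> connected A -> connected (f @` A).
Proof.
by move=> cf cA; apply: connected_continuous_connected => //;
  exact: continuous_subspaceT.
Qed.

End Connectedness.

(** * Metrics from coordinates *)

Lemma exists_exprN_lt (R : realType) (b e : R) : 1 < b -> 0 < e ->
  exists N, b ^- N < e.
Proof.
move=> b1 e0; have b0 : 0 < b by lra.
have ab : `|b^-1| < 1 by rewrite ger0_norm ?invr_ge0 ?ltW// invf_lt1.
have /cvgrPdist_lt/(_ e e0) [N _ /(_ N (leqnn N))] := cvg_expr ab.
rewrite /= sub0r normrN exprVn ger0_norm ?invr_ge0 ?exprn_ge0 ?ltW// => ?.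
by exists N.
Qed.

Section CoordinateMetric.
Variables (R : realType) (X : choiceType) (c : nat -> X -> R).

Definition bounded_coords := forall i x, 0 <= c i x <= 1.

Definition separating_coords := forall x y, (forall i, c i x = c i y) -> x = y.

(** The weights make all but finitely many coordinates negligible at a given
    scale; with them the supremum induces the topology of coordinatewise
    convergence. *)
Definition coord_dist (x y : X) : R :=
  sup [set 2 ^- i * `|c i x - c i y| | i in [set: nat]].

Hypothesis cb : bounded_coords.
Hypothesis cs : separating_coords.

Let le1 i x y : `|c i x - c i y| <= 1.
Proof. by have := cb i x; have := cb i y; rewrite ler_norml; lra. Qed.

Lemma coord_dist_ge x y i : 2 ^- i * `|c i x - c i y| <= coord_dist x y.
Proof.
apply: ub_le_sup; last by exists i.
exists 1 => _ [j _ <-]; rewrite -[leRHS]mulr1; apply: ler_pM => //.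
by rewrite invf_le1 ?exprn_gt0// exprn_ege1// ler1n.
Qed.

Lemma coord_dist_le x y e :
  (forall i, 2 ^- i * `|c i x - c i y| <= e) -> coord_dist x y <= e.
Proof.
move=> h; apply: ge_sup => [|_ [i _ <-]//].
by exists (2 ^- 0 * `|c 0%N x - c 0%N y|), 0%N.
Qed.

Let dist_xx x : coord_dist x x = 0.
Proof.
apply/eqP; rewrite eq_le; apply/andP; split.
  by apply: coord_dist_le => i; rewrite subrr normr0 mulr0.
by apply: le_trans (coord_dist_ge x x 0); rewrite subrr normr0 mulr0.
Qed.

Let dist_eq0 x y : coord_dist x y = 0 -> x = y.
Proof.
move=> d0; apply: cs => i; have := coord_dist_ge x y i.
rewrite d0 pmulr_rle0 ?invr_gt0 ?exprn_gt0// normr_le0.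
by rewrite subr_eq0 => /eqP.
Qed.

Let dist_sym x y : coord_dist x y = coord_dist y x.
Proof.
by congr sup; apply/seteqP; split => _ [i _ <-]; exists i => //; rewrite distrC.
Qed.

Let dist_triangle y x z : coord_dist x z <= coord_dist x y + coord_dist y z.
Proof.
apply: coord_dist_le => i.
apply: le_trans (lerD (coord_dist_ge x y i) (coord_dist_ge y z i)).
by rewrite -mulrDr ler_pM2l ?invr_gt0 ?exprn_gt0// ler_distD.
Qed.

(** The proofs are arguments of the alias so that the metric structure can be
    inferred from the type. *)
Definition coord_metric of bounded_coords & separating_coords : Type := X.

HB.instance Definition _ := Choice.copy (coord_metric cb cs) X.
HB.instance Definition _ := isMetric.Build R (coord_metric cb cs)
  dist_xx dist_eq0 dist_sym dist_triangle.

End CoordinateMetric.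

Lemma near_below (X : topologicalType) (x : X) (P : nat -> X -> Prop) n :
  (forall i, \forall y \near x, P i y) ->
  \forall y \near x, forall i, (i < n)%N -> P i y.
Proof.
move=> nP; elim: n => [|n IH]; first exact: filterE.
apply: filterS2 (nP n) IH => y Pn IH i.
by rewrite ltnS leq_eqVlt => /orP[/eqP -> //|]; exact: IH.
Qed.

(** The identity onto the coordinate metric is a continuous bijection from a
    compact space to a Hausdorff space. *)
Lemma metrizable_of_coords (R : realType) (X : topologicalType)
    (c : nat -> X -> R) :
  compact [set: X] -> (forall i, continuous (c i)) ->
  bounded_coords c -> separating_coords c -> metrizable R X.
Proof.
move=> cX cc cb cs; exists (coord_metric cb cs).
exists (id : X -> coord_metric cb cs).
apply: compact_hausdorff_homeomorphism => //; last by move=> y; exists y.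
  exact: metric_hausdorff.
move=> x U; rewrite nbhs_ballP => -[e /= e0]; rewrite ballEmdist => eU.
have lt12 : 1 < 2 :> R by rewrite ltr1n.
have [N Ne] := exists_exprN_lt lt12 e0.
have e2 : 0 < e / 2 by rewrite divr_gt0.
suff : \forall y \near x, coord_dist c x y < e by exact: filterS.
have : \forall y \near x, forall i, (i < N)%N -> `|c i x - c i y| < e / 2.
  by apply: near_below => i; have /cvgrPdist_lt/(_ _ e2) := cc i x.
apply: filterS => y h.
suff : coord_dist c x y <= Num.max (e / 2) (2 ^- N).
  by move=> /le_lt_trans; apply; rewrite gt_max Ne andbT; lra.
apply: coord_dist_le => i; have p0 j : 0 < 2 ^- j :> R.
  by rewrite invr_gt0 exprn_gt0.
rewrite le_max; case: (ltnP i N) => iN.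
  have := h i iN; have := p0 i; have : 2 ^- i <= 1 :> R.
    by rewrite invf_le1 ?exprn_gt0// exprn_ege1// ler1n.
  move=> h1 h2 h3; apply/orP; left; have := normr_ge0 (c i x - c i y); nra.
have d1 : `|c i x - c i y| <= 1.
  by have := cb i x; have := cb i y; rewrite ler_norml; lra.
apply/orP; right; apply: (@le_trans _ _ (2 ^- i)).
  by have := p0 i; nra.
by rewrite lef_pV2 ?posrE ?exprn_gt0// ler_eXn2l// ltr1n.
Qed.


(** * Arcs *)

Section Arcs.
Variables (R : realType) (X : topologicalType).
Hypothesis hX : hausdorff_space X.
Implicit Types (A B K : set X) (x y : X).

Lemma compact_unit_interval : compact [set: set_type (unit_interval R)].
Proof. by apply: compact_set_typeT; exact: segment_compact. Qed.

(** The interval is compact, so an injective path in a Hausdorff space is an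
    embedding. *)
Lemma arc_betweenP B x y : arc_between R B x y <->
  exists p : set_type (unit_interval R) -> X,
    [/\ continuous p, injective p, range p = B,
        forall t, set_val t = 0 -> p t = x &
        forall t, set_val t = 1 -> p t = y].
Proof.
split=> [[f [[cf [g [cg fK gK]]] f0 f1]]|[p [cp ip <- p0 p1]]].
  exists (fun t => set_val (f t)); split => //.
  - move=> t; apply: continuous_comp; first exact: cf.
    exact: continuous_set_val.
  - by move=> s t /set_val_inj /(can_inj fK).
  - apply/seteqP; split=> [_ [t _ <-]|z Bz]; first exact: set_valP.
    by exists (g (exist _ z (mem_set Bz))) => //; rewrite gK.
have rp t : p t \in range p by rewrite inE; exists t.
exists (fun t => exist _ (p t) (rp t)); split => //; last first.
apply: compact_hausdorff_homeomorphism.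
- exact: compact_unit_interval.
- exact: hausdorff_set_type.
- exact: continuous_to_set_type.
- by move=> s t /(congr1 set_val) /ip.
- move=> [z zr]; have [t _ tz] := set_mem zr; exists t.
  exact: set_val_inj.
Qed.

Lemma in_unit_interval (t : R) : 0 <= t <= 1 -> unit_interval R t.
Proof. by rewrite /unit_interval /= in_itv. Qed.

Definition unit_point (t : R) (t01 : 0 <= t <= 1) :
    set_type (unit_interval R) :=
  exist _ t (mem_set (in_unit_interval t01)).

Lemma unit_intervalP (t : set_type (unit_interval R)) : 0 <= set_val t <= 1.
Proof. by have := set_valP t; rewrite /unit_interval /= in_itv. Qed.

Lemma arc_between_ends B x y : arc_between R B x y -> B x /\ B y.
Proof.
move=> /arc_betweenP [p [_ _ <- p0 p1]]; split.
  have h : 0 <= (0 : R) <= 1 by rewrite lexx ler01.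
  by exists (unit_point h) => //; exact: p0.
have h : 0 <= (1 : R) <= 1 by rewrite lexx ler01.
by exists (unit_point h) => //; exact: p1.
Qed.

Lemma arc_between_compact B x y : arc_between R B x y -> compact B.
Proof.
move=> /arc_betweenP [p [cp _ <- _ _]]; apply: continuous_compact.
  exact: continuous_subspaceT.
exact: compact_unit_interval.
Qed.

Lemma arc_of_path (p : R -> X) :
  continuous p -> {in `[0, 1] &, injective p} ->
  arc_between R (p @` `[0, 1]) (p 0) (p 1).
Proof.
move=> cp ip; apply/arc_betweenP; exists (fun t => p (set_val t)); split.
- by move=> t; apply: continuous_comp; [exact: continuous_set_val|exact: cp].
- by move=> s t /ip st; apply: set_val_inj; apply: st;
    rewrite in_itv/= unit_intervalP.
- apply/seteqP; split => [_ [t _ <-]|_ [t t01 <-]].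
    by exists (set_val t) => //; exact: set_valP.
  by exists (exist _ t (mem_set t01)).
- by move=> t ->.
- by move=> t ->.
Qed.

Lemma arc_between_connected B x y : arc_between R B x y -> connected B.
Proof.
move=> /arc_betweenP [p [cp _ <- _ _]].
apply: connected_image => //.
pose clamp (t : R) := Num.max 0 (Num.min t 1).
have clamp01 t : 0 <= clamp t <= 1.
  by rewrite /clamp le_max lexx ge_max ler01 ge_min lexx orbT.
have -> : [set: set_type (unit_interval R)] =
    (fun t => unit_point (clamp01 t)) @` setT.
  apply/seteqP; split => // t _; exists (set_val t) => //.
  apply: set_val_inj; change (clamp (set_val t) = set_val t).
  have /andP[t0 t1] := unit_intervalP t.
  by rewrite /clamp min_l// max_r.
apply: connected_image; last by apply/connected_intervalP.
apply: continuous_to_set_type => /=; apply: continuous_max_fun.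
  by move=> t; exact: cvg_cst.
apply: continuous_min_fun; first by move=> t; exact: cvg_id.
by move=> t; exact: cvg_cst.
Qed.

(** If K missed a point of the arc, the images of the two parts of the interval
    on either side of this point would be disjoint closed sets that cover K. *)
Lemma arc_between_irreducible B K x y :
  arc_between R B x y -> connected K -> K `<=` B -> K x -> K y -> K = B.
Proof.
move=> /arc_betweenP [p [cp ip <- p0 p1]] cK KB Kx Ky.
apply/seteqP; split => // z [t _ <-]; apply: contrapT => nK.
pose C1 := p @` [set s | set_val s <= set_val t].
pose C2 := p @` [set s | set_val t <= set_val s].
have cl1 : closed C1.
  apply: compact_closed => //; apply: continuous_compact.
    exact: continuous_subspaceT.
  apply: subclosed_compact compact_unit_interval _ => //.
  apply: (@closed_le_fun R _ set_val (cst (set_val t))).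
    exact: continuous_set_val.
  exact: cst_continuous.
have cl2 : closed C2.
  apply: compact_closed => //; apply: continuous_compact.
    exact: continuous_subspaceT.
  apply: subclosed_compact compact_unit_interval _ => //.
  apply: (@closed_le_fun R _ (cst (set_val t)) set_val).
    exact: cst_continuous.
  exact: continuous_set_val.
have cov q : K q -> C1 q \/ C2 q.
  move=> /KB [s _ <-]; case: (leP (set_val s) (set_val t)) => st.
    by left; exists s.
  by right; exists s => //=; exact: ltW.
have dis q : K q -> C1 q -> ~ C2 q.
  move=> Kq [s st sq] [s' s't s'q]; apply: nK; suff -> : t = s by rewrite sq.
  have ss' : s = s' by apply: ip; rewrite sq.
  by apply: set_val_inj; apply/eqP; rewrite eq_le st andbT ss'.
have /seteqP[_ /(_ y Ky) [_ C1y]] : K `&` C1 = K.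
  apply: cK.
  - exists x; split => //.
    have h : 0 <= (0 : R) <= 1 by rewrite lexx ler01.
    exists (unit_point h); last by rewrite p0.
    by have /andP[] := unit_intervalP t.
  - exists (~` C2); first exact: closed_openC.
    apply/seteqP; split => q [Kq Cq]; split => //; first exact: dis.
    by have [] := cov _ Kq.
  - by exists C1.
apply: (dis y) => //.
have h : 0 <= (1 : R) <= 1 by rewrite lexx ler01.
exists (unit_point h); last by rewrite p1.
by have /andP[] := unit_intervalP t.
Qed.

End Arcs.

(** * Sets of sequences closed under truncation *)

(** The model is a compact set of real sequences that are bounded by their first
    entry, the height, and closed under cutting off all entries at a level s.
    The truncations of a point then form an arc that descends to the zero
    sequence. Coordinates on an abstract space are used because the theory is
    applied both to the inverse limit and to the trees that approximate it. *)
Record truncation_system (R : realType) (X : topologicalType) (A : set X)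
    (c : nat -> X -> R) : Prop := TruncationSystem {
  tr_hausdorff : hausdorff_space X;
  tr_compact : compact A;
  tr_continuous : forall i, continuous (c i);
  tr_bound : forall x i, A x -> 0 <= c i x <= c 0%N x;
  tr_bound1 : forall x, A x -> c 0%N x <= 1;
  tr_sep : forall x y, A x -> A y -> (forall i, c i x = c i y) -> x = y;
  tr_trunc : forall x s, A x -> 0 <= s ->
    exists2 y, A y & forall i, c i y = Num.min (c i x) s }.

Section TruncationSystem.
Variables (R : realType) (X : topologicalType) (A : set X).
Variable c : nat -> X -> R.
Hypothesis H : truncation_system A c.
Implicit Types (x y q : X) (K B : set X) (s t m e : R) (i : nat).

(** Separation makes the truncation unique. Clipping the level at 0 turns
    s |-> trunc x s into a path defined on the whole line. *)
Definition trunc x s : X :=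
  xget x [set y | A y /\ forall i, c i y = Num.min (c i x) (Num.max 0 s)].

Lemma truncP x s : A x ->
  A (trunc x s) /\ forall i, c i (trunc x s) = Num.min (c i x) (Num.max 0 s).
Proof.
move=> Ax; rewrite /trunc; case: xgetP => [y _ //|] /=.
have s0 : 0 <= Num.max 0 s by rewrite le_max lexx.
by have [y Ay yE] := tr_trunc H Ax s0 => /(_ y) [].
Qed.

Lemma truncA x s : A x -> A (trunc x s).
Proof. by move=> /(truncP s) []. Qed.

Lemma truncE x s i : A x -> 0 <= s -> c i (trunc x s) = Num.min (c i x) s.
Proof. by move=> /(truncP s) [_ ->] s0; rewrite (max_r s0). Qed.

Lemma trunc_height x s : A x -> 0 <= s <= c 0%N x -> c 0%N (trunc x s) = s.
Proof. by move=> Ax /andP[s0 sx]; rewrite truncE// min_r. Qed.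

Lemma coord_ge0 x i : A x -> 0 <= c i x.
Proof. by move=> /(tr_bound H i) /andP[]. Qed.

Lemma coord_le x i : A x -> c i x <= c 0%N x.
Proof. by move=> /(tr_bound H i) /andP[]. Qed.

Lemma trunc_eq x y s : A x -> A y ->
  (forall i, Num.min (c i x) s = Num.min (c i y) s) -> 0 <= s ->
  trunc x s = trunc y s.
Proof.
by move=> Ax Ay xy s0; apply: (tr_sep H) => // [||i]; rewrite ?truncE//;
  exact: truncA.
Qed.

Lemma trunc_id x s : A x -> c 0%N x <= s -> trunc x s = x.
Proof.
move=> Ax xs; apply: (tr_sep H) => // [|i]; first exact: truncA.
have x0 := coord_ge0 0 Ax; rewrite truncE//; last exact: le_trans xs.
by rewrite min_l// (le_trans (coord_le i Ax)).
Qed.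

Let coords x : prod_topology (fun _ : nat => (R : topologicalType)) :=
  fun i => c i x.

Lemma continuous_into (Z : topologicalType) (g : Z -> X) :
  (forall z, A (g z)) -> (forall i, continuous (fun z => c i (g z))) ->
  continuous g.
Proof.
move=> Ag cg; apply: (@continuous_through_compact _ _ _ A coords) => //.
- exact: tr_compact H.
- by apply: hausdorff_product => _; exact: Rhausdorff.
- by apply: continuous_to_prod => i; exact: tr_continuous H i.
- move=> x y Ax Ay xy; apply: (tr_sep H) => // i.
  exact: (congr1 (fun f => f i) xy).
- by apply: continuous_to_prod => i; exact: cg.
Qed.

Lemma continuous_trunc x : A x -> continuous (trunc x).
Proof.
move=> Ax; apply: continuous_into => [s|i]; first exact: truncA.
under eq_fun do rewrite (proj2 (truncP _ Ax)).
apply: continuous_min_fun; first exact: cst_continuous.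
by apply: continuous_max_fun; [exact: cst_continuous|move=> s; exact: cvg_id].
Qed.

Lemma segment_trunc_connected x a b : A x ->
  connected [set trunc x s | s in `[a, b]].
Proof.
move=> Ax; apply: connected_image; first exact: continuous_trunc.
exact: segment_connected.
Qed.

(** Y is swept out by the truncation arcs that descend to its lowest point b. *)
Definition starlike (Y : set X) b := [/\ Y `<=` A, Y b,
  forall q, Y q -> c 0%N b <= c 0%N q /\ trunc q (c 0%N b) = b &
  forall q s, Y q -> c 0%N b <= s <= c 0%N q -> Y (trunc q s)].

Lemma starlike_connected Y b : starlike Y b -> connected Y.
Proof.
move=> [YA Yb bot Yt].
have -> : Y = \bigcup_(q in Y) [set trunc q s | s in `[c 0%N b, c 0%N q]].
  apply/seteqP; split=> [q Yq|_ [q Yq [s /= + <-]]]; last first.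
    by rewrite in_itv/=; exact: Yt.
  exists q => //; exists (c 0%N q); last by rewrite trunc_id//; exact: YA.
  by rewrite /= in_itv/= lexx andbT; have [] := bot _ Yq.
apply: bigcup_connected.
  exists b => q Yq; exists (c 0%N b); last by have [] := bot _ Yq.
  by rewrite /= in_itv/= lexx; have [] := bot _ Yq.
by move=> q Yq; apply: segment_trunc_connected; exact: YA.
Qed.

Lemma truncation_system_connected : connected A.
Proof.
have [->|/set0P[x Ax]] := eqVneq A set0; first exact: connected0.
have h0 : c 0%N (trunc x 0) = 0 by rewrite truncE// min_r// coord_ge0.
apply: (@starlike_connected _ (trunc x 0)); split => //.
- exact: truncA.
- move=> q Aq; rewrite h0; split; first exact: coord_ge0.
  apply: trunc_eq => // i.
  by rewrite !min_r ?coord_ge0.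
- by move=> q s Aq _; exact: truncA.
Qed.

Lemma sub_metrizable B : B `<=` A -> compact B -> metrizable R (set_type B).
Proof.
move=> BA cB; apply: (@metrizable_of_coords _ _ (fun i z => c i (set_val z))).
- exact: compact_set_typeT.
- move=> i z; apply: continuous_comp; first exact: continuous_set_val.
  exact: tr_continuous H i _.
- move=> i z; have Az : A (set_val z) by apply: BA; exact: set_valP.
  by rewrite coord_ge0// (le_trans (coord_le _ _))// (tr_bound1 H).
- move=> z w zw; apply: set_val_inj; apply: (tr_sep H) => //;
    by apply: BA; exact: set_valP.
Qed.

Lemma truncation_system_continuum : A !=set0 -> continuum R A.
Proof.
split => //; first exact: tr_compact H.
  exact: truncation_system_connected.
by apply: sub_metrizable => //; exact: tr_compact H.
Qed.

(** The level up to which the truncation arcs of x and y coincide: truncations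
    at s agree exactly when s lies below every two coordinates that differ. *)
Definition meet_height x y : R :=
  inf (Num.min (c 0%N x) (c 0%N y) |`
       [set Num.min (c i x) (c i y) | i in [set i | c i x <> c i y]]).

Lemma meet_height_lb x y : A x -> A y ->
  lbound (Num.min (c 0%N x) (c 0%N y) |`
       [set Num.min (c i x) (c i y) | i in [set i | c i x <> c i y]]) 0.
Proof. by move=> Ax Ay _ [->|[i _ <-]]; rewrite le_min !coord_ge0. Qed.

Lemma meet_height_ge0 x y : A x -> A y -> 0 <= meet_height x y.
Proof.
move=> Ax Ay; apply: lb_le_inf; last exact: meet_height_lb.
by exists (Num.min (c 0%N x) (c 0%N y)); left.
Qed.

Lemma meet_height_le x y : A x -> A y ->
  meet_height x y <= Num.min (c 0%N x) (c 0%N y).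
Proof.
by move=> Ax Ay; apply: ge_inf; [exists 0; exact: meet_height_lb|left].
Qed.

Lemma meet_height_coord x y i : A x -> A y ->
  c i x = c i y \/ (meet_height x y <= c i x /\ meet_height x y <= c i y).
Proof.
move=> Ax Ay; have [|/eqP xy] := eqVneq (c i x) (c i y); first by left.
right; apply/andP; rewrite -le_min.
by apply: ge_inf; [exists 0; exact: meet_height_lb|right; exists i].
Qed.

Lemma meet_height_max x y s : s <= c 0%N x ->
  (forall i, Num.min (c i x) s = Num.min (c i y) s) -> s <= meet_height x y.
Proof.
move=> sx e; have sy : s <= c 0%N y.
  by have := e 0%N; rewrite (min_r sx) => ->; rewrite ge_min lexx.
apply: lb_le_inf; first by exists (Num.min (c 0%N x) (c 0%N y)); left.
move=> _ [->|[i /= xy <-]]; first by rewrite le_min sx.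
move: (e i); rewrite le_min.
by case: (leP (c i x) s); case: (leP (c i y) s) => h1 h2 E //; lra.
Qed.

Lemma meet_heightC x y : meet_height x y = meet_height y x.
Proof.
rewrite /meet_height minC; congr (inf (_ |` _)).
by apply/seteqP; split => _ [i /= xy <-]; exists i; rewrite 1?minC//=;
  exact: nesym.
Qed.

(** Descend from x to the level where the two truncation arcs meet, then ascend
    to y. *)
Definition standard_arc x y :=
  [set trunc x s | s in `[meet_height x y, c 0%N x]] `|`
  [set trunc y s | s in `[meet_height x y, c 0%N y]].

Let path x y s :=
  if s <= 0 then trunc x (meet_height x y - s)
  else trunc y (meet_height x y + s).

(** A formula without case distinction, in which continuity in s is visible. *)
Let pathE x y s i : A x -> A y -> c i (path x y s) =
  Num.max (Num.min (c i x) (meet_height x y - s))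
    (Num.min (c i y) (meet_height x y + s)).
Proof.
move=> Ax Ay; have m0 := meet_height_ge0 Ax Ay.
have x0 := coord_ge0 i Ax; have y0 := coord_ge0 i Ay.
rewrite /path; case: ifPn => [s0|]; last rewrite -ltNge => s0.
all: rewrite truncE//; try lra.
all: case: (meet_height_coord i Ax Ay) => [|[]].
all: move: (meet_height x y) m0 => m m0.
all: move: (c i x) (c i y) x0 y0 => a b a0 b0.
all: case: (leP a (m - s)); case: (leP b (m + s));
  [case: (leP a b)|case: (leP a (m + s))|
   case: (leP (m - s) b)|case: (leP (m - s) (m + s))]; lra.
Qed.

(** Along the path the height is the meeting level plus |s|, so two parameters
    with the same image agree up to sign; opposite parameters would give equal
    truncations of x and y above the meeting level. *)
Lemma standard_arcP x y : A x -> A y -> x <> y ->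
  arc_between R (standard_arc x y) x y.
Proof.
move=> Ax Ay xy; set m := meet_height x y.
have m0 : 0 <= m := meet_height_ge0 Ax Ay.
have [mx my] : m <= c 0%N x /\ m <= c 0%N y.
  by apply/andP; rewrite -le_min; exact: meet_height_le.
have agree i : Num.min (c i x) m = Num.min (c i y) m.
  by have [->//|[/min_r -> /min_r ->]] := meet_height_coord i Ax Ay.
have txy : trunc x m = trunc y m by exact: trunc_eq.
have len : m - c 0%N x < c 0%N y - m.
  rewrite ltNge; apply/negP => le; apply: xy.
  by rewrite -(@trunc_id x m)//; [rewrite -(@trunc_id y m)//; lra|lra].
pose sg t := (1 - t) * (m - c 0%N x) + t * (c 0%N y - m).
pose p t := path x y (sg t).
have sg0 : sg 0 = m - c 0%N x by rewrite /sg; ring.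
have sg1 : sg 1 = c 0%N y - m by rewrite /sg; ring.
have sgr t : 0 <= t <= 1 -> m - c 0%N x <= sg t <= c 0%N y - m.
  by rewrite /sg; nra.
have sgs s : m - c 0%N x <= s <= c 0%N y - m ->
    exists2 t, 0 <= t <= 1 & sg t = s.
  move=> sr; have d0 : 0 < c 0%N y + c 0%N x - 2 * m by lra.
  exists ((s - (m - c 0%N x)) / (c 0%N y + c 0%N x - 2 * m)).
    by rewrite divr_ge0 ?ler_pdivrMr//; lra.
  by rewrite /sg; field; rewrite gt_eqF.
have p0 : p 0 = x.
  rewrite /p sg0 /path -/m ifT; last lra.
  by apply: trunc_id => //; lra.
have p1 : p 1 = y.
  rewrite /p sg1 /path -/m; case: ifPn => [h|_].
    have -> : m - (c 0%N y - m) = m by lra.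
    by rewrite txy; apply: trunc_id => //; lra.
  by apply: trunc_id => //; lra.
have pA t : A (p t) by rewrite /p /path; case: ifP => _; exact: truncA.
have cp : continuous p.
  apply: continuous_into => // i; under eq_fun do rewrite pathE//.
  have csg : continuous sg.
    move=> t; apply: cvgD; apply: cvgMl; last exact: cvg_id.
    by apply: cvgB; [exact: cvg_cst|exact: cvg_id].
  apply: continuous_max_fun; apply: continuous_min_fun;
    try exact: cst_continuous.
    by move=> t; apply: cvgB; [exact: cvg_cst|exact: csg].
  by move=> t; apply: cvgD; [exact: cvg_cst|exact: csg].
have height t : 0 <= t <= 1 -> c 0%N (p t) = m + `|sg t|.
  move=> /sgr st; rewrite /p /path -/m; case: ifPn => [h|].
    by rewrite truncE//; [rewrite min_r ?ler0_norm//; lra|lra].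
  rewrite -ltNge => h.
  by rewrite truncE//; [rewrite min_r ?gtr0_norm//; lra|lra].
(* Equal images at opposite parameters would contradict the choice of m. *)
have branch t t' : 0 <= t <= 1 -> 0 <= t' <= 1 -> p t = p t' ->
    sg t <= 0 -> sg t' <= 0.
  move=> t01 t'01 ptt' st; rewrite leNgt; apply/negP => st'.
  have := height _ t01; rewrite ptt' height// (ler0_norm st) (gtr0_norm st').
  move=> hh; have := sgr _ t01; have := sgr _ t'01 => r' r.
  move: ptt'; rewrite /p /path -/m st ifF; last by apply/negbTE; rewrite -ltNge.
  have -> : m - sg t = m + sg t' by lra.
  move=> E; suff : m + sg t' <= m by lra.
  apply: meet_height_max => //; first lra.
  by move=> i; have := congr1 (c i) E; rewrite !truncE//; lra.
have -> : standard_arc x y = p @` `[0, 1].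
  apply/seteqP; split.
    move=> z [] [s /=]; rewrite in_itv/= -/m => /andP[ms sx] <-.
      have [|t t01 st] := sgs (m - s); first lra.
      exists t; rewrite /= ?in_itv//= /p /path -/m st ifT; last lra.
      by congr trunc; lra.
    have [|t t01 st] := sgs (s - m); first lra.
    exists t; rewrite /= ?in_itv//= /p /path -/m st; case: ifPn => [h|_].
      have -> : s = m by lra.
      by rewrite subrr subr0.
    by congr trunc; lra.
  move=> z [t /=]; rewrite in_itv/= => /sgr /andP[st1 st2] <-.
  rewrite /p /path -/m; case: ifPn => [h|]; last rewrite -ltNge => h.
    left; exists (m - sg t) => //; rewrite /= in_itv/= -/m; lra.
  right; exists (m + sg t) => //; rewrite /= in_itv/= -/m; lra.
rewrite -[in X in arc_between _ _ X _]p0 -[in X in arc_between _ _ _ X]p1.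
apply: arc_of_path => //; first exact: tr_hausdorff H.
move=> t t'; rewrite !in_itv/= => t01 t'01 E.
have sE : sg t = sg t'.
  have hh : `|sg t| = `|sg t'|.
    by have := height _ t01; rewrite E height// => /addrI.
  have b1 := branch _ _ t01 t'01 E; have b2 := branch _ _ t'01 t01 (esym E).
  move: hh; have [s0|s0] := leP (sg t) 0.
    by rewrite !ler0_norm// ?b1//; lra.
  have s0' : 0 < sg t' by rewrite ltNge; apply/negP => /b2; lra.
  by rewrite !gtr0_norm.
by move: sE len; rewrite /sg; nra.
Qed.

Lemma standard_arc_sub x y : A x -> A y -> standard_arc x y `<=` A.
Proof. by move=> Ax Ay _ [] [s _ <-]; exact: truncA. Qed.

Lemma truncation_system_arcwise_connected : arcwise_connected R A.
Proof.
move=> x y Ax Ay xy; exists (standard_arc x y); first exact: standard_arc_sub.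
exact: standard_arcP.
Qed.

(** A compact set contains every point that its elements approximate in finitely
    many coordinates at a time, because the coordinates separate points. *)
Lemma coordinate_limit K q : K `<=` A -> compact K -> A q ->
  (forall e n, 0 < e ->
    exists2 x, K x & forall i, (i < n)%N -> `|c i x - c i q| <= e) -> K q.
Proof.
move=> KA cK Aq h.
pose N (p : R * nat) :=
  [set x | K x /\ forall i, (i < p.2)%N -> `|c i x - c i q| <= p.1].
pose F := filter_from [set p : R * nat | 0 < p.1] N.
have FF : ProperFilter F.
  apply: filter_from_proper; last first.
    by move=> [e n] /= /(h _ n) [x Kx xe]; exists x.
  apply: filter_from_filter; first by exists (1, 0%N) => /=.
  move=> [e n] [e' n'] /= e0 e0'; exists (Num.min e e', maxn n n') => /=.
    by rewrite lt_min e0.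
  move=> x [Kx /= xe]; split; split => // i /= ni; have := xe i;
    by rewrite le_min leq_max ni ?orbT => /(_ isT) /andP[].
have [x [Kx Fx]] : K `&` cluster F !=set0.
  by apply: cK; exists (1, 0%N) => //= x [].
suff <- : x = q by [].
apply: (tr_sep H) => // [|i]; first exact: KA.
apply/eqP; rewrite -subr_eq0 -normr_eq0 eq_le normr_ge0 andbT.
apply/ler_addgt0Pl => e e0; rewrite addr0.
have cl : closed [set z | `|c i z - c i q| <= e].
  apply: (@closed_le_fun R _ (fun z => `|c i z - c i q|) (cst e)).
    move=> z; apply: cvg_norm; apply: cvgB; last exact: cvg_cst.
    exact: tr_continuous H i _.
  exact: cst_continuous.
apply: cl => U Ux; have [||z [[_ ze] Uz]] := Fx (N (e, i.+1)) U => //.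
  by exists (e, i.+1).
by exists z; split => //=; exact: ze.
Qed.

End TruncationSystem.

(** * Approximation by trees *)

(** The maps q |-> (r M i q)_i approximate the identity uniformly and commute
    with truncation. Local constancy of the truncation above the level s says
    that in their images each point at height s separates what lies above it
    from the rest, as in a tree. *)
Record tree_approximations (R : realType) (X : topologicalType) (A : set X)
    (c : nat -> X -> R) (r : nat -> nat -> X -> R) : Prop :=
  TreeApproximations {
  ta_trunc : forall M i q q' s, A q -> A q' -> 0 <= s ->
    (forall j, c j q' = Num.min (c j q) s) -> r M i q' = Num.min (r M i q) s;
  ta_continuous : forall M i q e, A q -> 0 < e ->
    \forall q' \near q, A q' -> `|r M i q - r M i q'| < e;
  ta_locally_constant : forall M q s, A q -> 0 <= s < c 0%N q ->
    \forall q' \near q, A q' -> forall i,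
      Num.min (r M i q') s = Num.min (r M i q) s;
  ta_near : forall e, 0 < e -> exists N, forall M i q, (N <= M)%N -> A q ->
    `|r M i q - c i q| < e }.

Section TreeApproximations.
Variables (R : realType) (X : topologicalType) (A : set X).
Variables (c : nat -> X -> R) (r : nat -> nat -> X -> R).
Hypothesis H : truncation_system A c.
Hypothesis Hr : tree_approximations A c r.
Implicit Types (x y q : X) (K B : set X) (s t m e : R) (i : nat).
Local Notation trunc := (trunc A c).
Local Notation meet_height := (meet_height c).

Lemma dist_min_le (a b s : R) : `|Num.min a s - Num.min b s| <= `|a - b|.
Proof.
by rewrite ler_norml; case: (leP a s); case: (leP b s); case: (ler0P (a - b));
  lra.
Qed.

Lemma ta_le_height M i q : A q -> r M i q <= c 0%N q.
Proof.
move=> Aq; rewrite (ta_trunc Hr M i Aq Aq (coord_ge0 H 0 Aq)).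
  by rewrite ge_min lexx orbT.
by move=> j; rewrite min_l// (coord_le H).
Qed.

Lemma near_height_gt q s : s < c 0%N q -> \forall q' \near q, s < c 0%N q'.
Proof. by move=> /(cvgr_gt _ (@tr_continuous _ _ _ _ H 0%N q)). Qed.

Lemma near_height_lt q s : c 0%N q < s -> \forall q' \near q, c 0%N q' < s.
Proof. by move=> /(cvgr_lt _ (@tr_continuous _ _ _ _ H 0%N q)). Qed.

(** If the M-th image of K missed the truncation of x at s, the points of K
    whose image lies strictly above this truncation would be relatively clopen
    in K; they include x and exclude y. *)
Lemma approximate_cut K x y s M : K `<=` A -> connected K -> K x -> K y ->
  0 <= s < c 0%N x ->
  (exists i, Num.min (r M i x) s <> Num.min (r M i y) s) ->
  exists2 q, K q & forall i, r M i q = Num.min (r M i x) s.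
Proof.
move=> KA cK Kx Ky /andP[s0 sx] [i0 xy]; apply: contrapT => nq.
pose P q := s < c 0%N q /\ forall i, Num.min (r M i q) s = Num.min (r M i x) s.
suff [_ /(_ i0) /esym//] : P y.
have op q : K q -> P q -> \forall q' \near q, K q' -> P q'.
  move=> Kq [sq qx]; have s0q : 0 <= s < c 0%N q by rewrite s0.
  have := ta_locally_constant Hr M (KA _ Kq) s0q.
  apply: filterS2 (near_height_gt sq) => q' sq' h Kq'; split => // i.
  by rewrite h//; exact: KA.
have cl q : K q -> ~ P q -> \forall q' \near q, K q' -> ~ P q'.
  move=> Kq nP; have Aq := KA _ Kq; have [qs|sq] := ltP (c 0%N q) s.
    by apply: filterS (near_height_lt qs) => q' q's _ [/lt_trans/(_ q's)];
      rewrite ltxx.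
  have [i qx] : exists i, Num.min (r M i q) s <> Num.min (r M i x) s.
    apply/existsNP => e; move: sq; rewrite le_eqVlt => /orP[/eqP sq|sq].
      by apply: nq; exists q => // i; rewrite -e min_l// sq ta_le_height.
    exact: nP.
  set d := `|Num.min (r M i q) s - Num.min (r M i x) s|.
  have d0 : 0 < d by rewrite normr_gt0 subr_eq0; exact/eqP.
  apply: filterS (ta_continuous Hr M i Aq d0) => q' h Kq' [_ /(_ i) e].
  have := le_lt_trans (dist_min_le _ _ s) (h (KA _ Kq')).
  by rewrite e ltxx.
by apply: (connected_local_invariant cK op cl Kx Ky); split.
Qed.

(** A form of hereditary unicoherence. At a level above the meeting level the
    approximations eventually tell x and y apart, so K contains points that
    approximate the truncation of x; the meeting level is a limit from above. *)
Lemma continuum_contains_cuts K x y s : K `<=` A -> compact K -> connected K ->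
  K x -> K y -> meet_height x y <= s <= c 0%N x -> K (trunc x s).
Proof.
move=> KA cK conK Kx Ky.
have Ax := KA _ Kx; have Ay := KA _ Ky; have m0 := meet_height_ge0 H Ax Ay.
have strict t : meet_height x y < t <= c 0%N x -> K (trunc x t).
  move=> /andP[mt]; rewrite le_eqVlt => /orP[/eqP ->|tx].
    by rewrite (trunc_id H).
  have t0 : 0 <= t by lra.
  have At := truncA H t Ax.
  have [i xy] : exists i, Num.min (c i x) t <> Num.min (c i y) t.
    apply/existsNP => e; have := meet_height_max (ltW tx) e; lra.
  set d := `|Num.min (c i x) t - Num.min (c i y) t|.
  have d0 : 0 < d by rewrite normr_gt0 subr_eq0; exact/eqP.
  apply: (coordinate_limit H KA cK At) => e n e0.
  have [N1 near1] := ta_near Hr (divr_gt0 d0 (ltr0n _ 2)).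
  have e2 : 0 < e / 2 by rewrite divr_gt0.
  have [N2 near2] := ta_near Hr e2.
  pose M := maxn N1 N2.
  have [||q Kq qE] := @approximate_cut K x y t M KA conK Kx Ky.
  - by rewrite t0 tx.
  - exists i => E; have hx := near1 M i x (leq_maxl _ _) Ax.
    have hy := near1 M i y (leq_maxl _ _) Ay.
    have : d < d.
      apply: (@le_lt_trans _ _ (`|r M i x - c i x| + `|r M i y - c i y|)).
        apply: le_trans (lerD (dist_min_le _ _ t) (dist_min_le _ _ t)).
        rewrite E distrC (_ : d = `|(Num.min (c i x) t - Num.min (r M i y) t)
          + (Num.min (r M i y) t - Num.min (c i y) t)|) ?ler_normD//.
        by rewrite /d; congr `|_|; ring.
      by lra.
    by rewrite ltxx.
  exists q => // j _.
  have hq := near2 M j q (leq_maxr _ _) (KA _ Kq).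
  have ht := near2 M j _ (leq_maxr _ _) At.
  have qt : r M j q = r M j (trunc x t).
    rewrite qE; symmetry; apply: (ta_trunc Hr) => // k.
    by rewrite (truncE H).
  rewrite qt distrC in hq.
  have := ler_normD (c j q - r M j (trunc x t))
    (r M j (trunc x t) - c j (trunc x t)).
  have -> : c j q - r M j (trunc x t) + (r M j (trunc x t) - c j (trunc x t)) =
    c j q - c j (trunc x t) by ring.
  lra.
move=> /andP[]; rewrite le_eqVlt => /orP[/eqP <- mx|ms sx]; last first.
  by apply: strict; rewrite ms.
move: mx; rewrite le_eqVlt => /orP[/eqP ->|mx]; first by rewrite (trunc_id H).
apply: (coordinate_limit H KA cK (truncA H _ Ax)) => e n e0.
pose t := Num.min (c 0%N x) (meet_height x y + e).
have mt : meet_height x y < t by rewrite lt_min mx; lra.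
exists (trunc x t) => [|i _]; first by apply: strict; rewrite mt ge_min lexx.
have te : t <= meet_height x y + e by rewrite ge_min lexx orbT.
rewrite !(truncE H)//; last lra.
rewrite ler_norml.
by case: (leP (c i x) t); case: (leP (c i x) (meet_height x y)); lra.
Qed.

Lemma standard_arc_sub_continuum K x y : K `<=` A -> compact K ->
  connected K -> K x -> K y -> standard_arc A c x y `<=` K.
Proof.
move=> KA cK conK Kx Ky z [] [s /=]; rewrite in_itv/= => sr <-.
  exact: continuum_contains_cuts Kx Ky sr.
by apply: (continuum_contains_cuts KA cK conK Ky Kx); rewrite meet_heightC.
Qed.

(** Every arc from x to y contains the standard one and is irreducible between
    its ends. *)
Theorem tree_approximations_uniquely_arcwise_connected :
  uniquely_arcwise_connected R A.
Proof.
move=> x y Ax Ay xy; exists (standard_arc A c x y); split.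
  by split; [exact: standard_arc_sub|exact: standard_arcP].
move=> B [BA arcB]; have hX := tr_hausdorff H.
have [Bx By] := arc_between_ends hX arcB.
apply: (arc_between_irreducible hX arcB).
- exact (arc_between_connected hX (standard_arcP H Ax Ay xy)).
- apply: standard_arc_sub_continuum => //.
    exact (arc_between_compact hX arcB).
  exact (arc_between_connected hX arcB).
- by have [] := arc_between_ends hX (standard_arcP H Ax Ay xy).
- by have [] := arc_between_ends hX (standard_arcP H Ax Ay xy).
Qed.

(** A point b of least height: the arcs from the points of K to b stay in K, so
    they cannot descend below b and must pass through it. *)
Lemma continuum_root K : K `<=` A -> compact K -> connected K -> K !=set0 ->
  exists b, starlike A c K b.
Proof.
move=> KA cK conK K0.
have [|b] := compact_EVT_min K0 cK (f := c 0%N).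
  by apply: continuous_subspaceT; exact: (@tr_continuous _ _ _ _ H 0%N).
rewrite inE => Kb bmin; have Ab := KA _ Kb.
have bq q : K q -> c 0%N b <= c 0%N q by move=> Kq; apply: bmin; rewrite inE.
have mb q : K q -> meet_height q b = c 0%N b.
  move=> Kq; have Aq := KA _ Kq; have m0 := meet_height_ge0 H Aq Ab.
  have := meet_height_le H Aq Ab; rewrite le_min => /andP[mq mb].
  have mqb : 0 <= meet_height q b <= c 0%N q by rewrite m0.
  apply/eqP; rewrite eq_le mb -[leRHS](trunc_height H Aq mqb) /=.
  by apply: bq; apply: (continuum_contains_cuts KA cK conK Kq Kb); rewrite lexx.
exists b; split => // [q Kq|q s Kq sr].
  split; first exact: bq.
  have Aq := KA _ Kq.
  rewrite -[RHS](trunc_id H Ab (lexx _)).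
  apply: (trunc_eq H) => // [i|]; last exact (coord_ge0 H 0%N Ab).
  have := meet_height_coord H i Aq Ab; rewrite mb//.
  by move=> [->//|[/min_r -> /min_r ->]].
by apply: (continuum_contains_cuts KA cK conK Kq Kb); rewrite mb.
Qed.

Lemma starlike_continuum K b : closed K -> starlike A c K b -> continuum R K.
Proof.
move=> clK st; have [KA Kb _ _] := st.
have cK : compact K by apply: subclosed_compact clK (tr_compact H) KA.
split => //; first by exists b.
  exact (starlike_connected H st).
exact (sub_metrizable H KA cK).
Qed.

(** A subcontinuum B is starlike from its lowest point b. Cut it at a level s
    between b and some higher point, into the part D up to s and the closure C
    of the part above s. The set D is a continuum. If C is connected, then C and
    D decompose B. If C is the union of two disjoint closed pieces, then D with
    either piece is still starlike, and these two continua decompose B. *)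
Theorem tree_approximations_hereditarily_decomposable :
  hereditarily_decomposable R A.
Proof.
move=> B BA [B0 cB conB _] [x0 [x1 [Bx0 Bx1 x01]]].
have clB : closed B := compact_closed (tr_hausdorff H) cB.
have [b stB] := continuum_root BA cB conB B0.
have [_ Bb bot Bt] := stB.
have [x Bx bx] : exists2 x, B x & c 0%N b < c 0%N x.
  apply: contrapT => n; have eqb q : B q -> q = b.
    move=> Bq; have [bq <-] := bot _ Bq.
    rewrite (trunc_id H)//; first exact: BA.
    by rewrite leNgt; apply/negP => bq'; apply: n; exists q.
  by apply: x01; rewrite (eqb x0)// (eqb x1).
set h0 := c 0%N b in bx bot Bt.
pose s := (h0 + c 0%N x) / 2.
have h00 : 0 <= h0 := coord_ge0 H 0%N (BA _ Bb).
have [sb sx] : h0 < s /\ s < c 0%N x by rewrite /s; lra.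
pose D := B `&` [set q | c 0%N q <= s].
pose E := B `&` [set q | s < c 0%N q].
pose C := closure E.
have clD : closed D.
  apply: closedI => //; apply: (@closed_le_fun R _ (c 0%N) (cst s)).
    exact: (@tr_continuous _ _ _ _ H 0%N).
  exact: cst_continuous.
have CB : C `<=` B by rewrite /C closureE; apply: smallest_sub => // q [].
have Cs q : C q -> s <= c 0%N q.
  have clS : closed [set q | s <= c 0%N q].
    apply: (@closed_le_fun R _ (cst s) (c 0%N)); first exact: cst_continuous.
    exact: (@tr_continuous _ _ _ _ H 0%N).
  by move: q; rewrite /C closureE; apply: smallest_sub => // p [_ /= /ltW].
have EC : E `<=` C by exact: subset_closure.
have BDC : D `|` C = B.
  apply/seteqP; split=> [q [[]//|/CB//]|q Bq].
  by have [qs|sq] := leP (c 0%N q) s; [left|right; exact: EC].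
have trE q t : E q -> s < t <= c 0%N q -> E (trunc q t).
  move=> [Bq /= sq] /andP[st tq].
  split; first by apply: Bt => //; rewrite tq andbT; lra.
  by rewrite /= (trunc_height H)//; [exact: BA|lra].
have cC : compact C by apply: subclosed_compact cB CB; exact: closed_closure.
have CA : C `<=` A by move=> q /CB /BA.
have trC q t : C q -> s <= t <= c 0%N q -> C (trunc q t).
  move=> Cq /andP[st tq]; have Aq := CA _ Cq.
  apply: (coordinate_limit H CA cC (truncA H t Aq)) => e n e0.
  have e2 : 0 < e / 2 by rewrite divr_gt0.
  have /Cq[p [Ep pq]] :
      \forall p \near q, forall i, (i < n)%N -> `|c i q - c i p| < e / 2.
    apply: near_below => i.
    by have /cvgrPdist_lt/(_ _ e2) := @tr_continuous _ _ _ _ H i q.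
  have Ap : A p by case: Ep => /BA.
  (* At the level s itself the truncation of p would leave E. *)
  pose u := t + e / 2; have su : s < u by rewrite /u; lra.
  exists (trunc p u) => [|i ni].
    apply: EC; have [up|pu] := leP u (c 0%N p).
      by apply: trE; rewrite ?su.
    by rewrite (trunc_id H)// ltW.
  rewrite !(truncE H)//; try lra.
  have := pq i ni; rewrite ltr_norml ler_norml /u; move: (c i p) (c i q) => a d.
  by case: (leP a (t + e / 2)); case: (leP d t); lra.
have stD : starlike A c D b.
  split => //.
  - by move=> q [/BA].
  - by split => //=; exact: ltW.
  - by move=> q [Bq _]; exact: bot.
  - move=> q t [Bq /= qs]; rewrite -/h0 => /andP[bt tq].
    split; first by apply: Bt => //; rewrite bt.
    have t0 : 0 <= t by lra.
    by rewrite /= (trunc_height H) ?t0//; [lra|exact: BA].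
have contD := starlike_continuum clD stD.
have [conC|nconC] := pselect (connected C).
  exists C, D; split => //.
  - by split => //; [exists x; exact: EC|exact (sub_metrizable H CA cC)].
  - by split => // /(_ _ Bb) /Cs; rewrite -/h0; lra.
  - by split => [q []//|/(_ _ Bx) [_ /=]]; lra.
  - by rewrite setUC.
have half (P P' : set X) : closed P -> closed P' -> P `|` P' = C ->
    P `&` P' = set0 -> P' !=set0 -> continuum R (D `|` P) /\ D `|` P `<` B.
  move=> clP clP' cov dis [z P'z].
  have PC : P `<=` C by rewrite -cov; exact: subsetUl.
  have P'C : P' `<=` C by rewrite -cov; exact: subsetUr.
  have PP' q : P q -> ~ P' q.
    by move=> Pq P'q; have : (P `&` P') q by []; rewrite dis.
  have near_out Q q : closed Q -> ~ Q q -> \forall q' \near q, ~ Q q'.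
    by move=> clQ nQ; apply: open_nbhs_nbhs; split => //; exact: closed_openC.
  split.
    apply: (@starlike_continuum _ b); first exact: closedU.
    split; [|by left; case: stD| |].
    - by move=> q [[/BA]|/PC /CA].
    - by move=> q [[Bq _]|/PC /CB Bq]; exact: bot.
    - move=> q t [Dq|Pq]; rewrite -/h0 => /andP[bt tq].
        by left; have [_ _ _] := stD; apply => //; rewrite -/h0 bt.
      have Cq := PC _ Pq; have Aq := CA _ Cq.
      have [ts|st] := leP t s.
        left; split; first by apply: Bt; [exact: CB|rewrite bt].
        have t0 : 0 <= t by lra.
        by rewrite /= (trunc_height H) ?t0.
      (* The arc from q down to the level t lies in C, hence in one piece. *)
      right; have sub p : [set trunc q u | u in `[t, c 0%N q]] p -> P p \/ P' p.
        move=> [u /=]; rewrite in_itv/= => /andP[tu uq] <-.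
        have : C (trunc q u) by apply: trC => //; rewrite uq andbT; lra.
        by rewrite -cov.
      apply: (@connected_local_invariant X [set trunc q u | u in `[t, c 0%N q]]
        P q (trunc q t)) => //.
      + exact (segment_trunc_connected H Aq).
      + move=> p _ /PP' nP'; apply: filterS (near_out _ _ clP' nP') => p' nP'p'.
        by move=> /sub [].
      + by move=> p _ nP; apply: filterS (near_out _ _ clP nP).
      + exists (c 0%N q); last by rewrite (trunc_id H).
        by rewrite /= in_itv/= lexx andbT.
      + by exists t => //; rewrite /= in_itv/= lexx.
  split; first by move=> q [[]//|/PC /CB].
  move=> BDP; have Cz := P'C _ P'z.
  have [|e [Ee nPe]] := Cz _ (near_out _ z clP _).
    by move=> Pz; exact: PP' Pz P'z.
  case: (BDP e) => [|[_ /=]|//]; first by case: Ee.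
  by case: Ee => _ /=; lra.
have [Z [Z0 ZC [V oV ZV] [W cW ZW]]] : exists Z, [/\ Z !=set0, Z <> C,
    exists2 V, open V & Z = C `&` V & exists2 W, closed W & Z = C `&` W].
  apply: contrapT => n; apply: nconC => Z Z0 ZV ZW; apply: contrapT => ZC.
  by apply: n; exists Z.
pose Z' := C `&` ~` V.
have clC : closed C by exact: closed_closure.
have clZ : closed Z by rewrite ZW; exact: closedI.
have clZ' : closed Z' by apply: closedI => //; exact: open_closedC.
have ZZ' : Z `|` Z' = C by rewrite ZV -setIUr setUv setIT.
have dis : Z `&` Z' = set0 by rewrite ZV setIACA setICr setI0.
have Z'0 : Z' !=set0.
  by apply: contrapT => /nonemptyPn e; apply: ZC; rewrite -ZZ' e setU0.
have [cZ pZ] := half _ _ clZ clZ' ZZ' dis Z'0.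
have [||cZ' pZ'] := half _ _ clZ' clZ _ _ Z0.
- by rewrite setUC.
- by rewrite setIC.
exists (D `|` Z), (D `|` Z'); split => //.
by rewrite setUACA setUid ZZ'.
Qed.

End TreeApproximations.

(** * The set-valued map *)

Section HairyArc.
Variable R : realType.
Implicit Types (a b s t : R) (k M N : nat) (j : int).

(** The values allowed over a measure how badly triadic rationals approximate a:
    b is allowed when |a - j / 3^(k^2)| >= b / (4 * 3^(k^2)) for all k and j.
    The squares keep consecutive scales far apart. *)
Definition hair a b := forall k j, b <= 4 * `|3 ^+ (k ^ 2) * a - j%:~R|.

Definition hairy_rel a b := b = a / 3 \/ (a / 3 <= b /\ hair a b).

Definition on_grid M t := exists j, t = j%:~R / 3 ^+ M.

Lemma on_grid0 M : on_grid M 0.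
Proof. by exists 0; rewrite mul0r. Qed.

Lemma pow3_gt0 n : 0 < 3 ^+ n :> R.
Proof. by rewrite exprn_gt0. Qed.

Lemma pow3_neq0 n : 3 ^+ n != 0 :> R.
Proof. by rewrite gt_eqF// pow3_gt0. Qed.

Lemma pow3_ge1 n : 1 <= 3 ^+ n :> R.
Proof. by rewrite exprn_ege1// ler1n. Qed.

Lemma hair_on_grid M a b : on_grid M a -> hair a b -> b <= 0.
Proof.
move=> [j ->] /(_ M (j * 3 ^+ (M ^ 2 - M))); congr (_ <= _).
have le : (M <= M ^ 2)%N by case: M => // M; rewrite -mulnn leq_pmulr.
rewrite rmorphM/= rmorphXn/= -{1}(subnK le) exprD.
rewrite (_ : _ - _ = 0) ?normr0 ?mulr0//.
by have := pow3_neq0 M; move=> h; field.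
Qed.

Lemma hairy_rel_ge a b : hairy_rel a b -> a / 3 <= b.
Proof. by case=> [->//|[]]. Qed.

Lemma hairy_rel_on_grid M a b : 0 <= a -> on_grid M a -> hairy_rel a b ->
  b = a / 3.
Proof.
by move=> a0 ga [//|[ab /(hair_on_grid ga) b0]]; lra.
Qed.

Lemma hair_le a b b' : b' <= b -> hair a b -> hair a b'.
Proof. by move=> bb h k j; exact: le_trans (h k j). Qed.

(** Moving a by 3^(-N^2) shifts the integer j at the scales k >= N, and changes
    the distance by at most 3^(-N) at the scales k < N. So every hair is
    approached by hairs of nearly the same length from both sides. *)
Lemma hair_shift N a b (z : bool) : (0 < N)%N -> hair a b ->
  hair (a + (-1) ^+ z / 3 ^+ (N ^ 2)) (b - 4 / 3 ^+ N).
Proof.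
move=> N0 h k j; have pN := pow3_gt0 N; have pn := pow3_neq0 (N ^ 2).
have [Nk|kN] := leqP N k.
  have le : (N ^ 2 <= k ^ 2)%N by rewrite leq_sqr.
  have := h k (j - (-1) ^+ z * 3 ^+ (k ^ 2 - N ^ 2)).
  rewrite rmorphB rmorphM/= !rmorphXn/= rmorphN1.
  have -> : 3 ^+ (k ^ 2) * a - (j%:~R - (-1) ^+ z * 3%:~R ^+ (k ^ 2 - N ^ 2)) =
      3 ^+ (k ^ 2) * (a + (-1) ^+ z / 3 ^+ (N ^ 2)) - j%:~R.
    by rewrite -{1 3}(subnK le) exprD; field.
  by move=> /(le_trans _); apply; rewrite gerDl oppr_le0 divr_ge0// ltW.
have -> : 3 ^+ (k ^ 2) * (a + (-1) ^+ z / 3 ^+ (N ^ 2)) - j%:~R =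
  (3 ^+ (k ^ 2) * a - j%:~R) + (-1) ^+ z * (3 ^+ (k ^ 2) / 3 ^+ (N ^ 2)).
  by field.
have small : `|(-1) ^+ z * (3 ^+ (k ^ 2) / 3 ^+ (N ^ 2))| <= 3 ^- N :> R.
  rewrite normrM normrX normrN1 expr1n mul1r ger0_norm; last first.
    by rewrite divr_ge0// ltW// pow3_gt0.
  rewrite ler_pdivrMr ?pow3_gt0// mulrC ler_pdivlMr// -exprD.
  rewrite ler_eXn2l ?ltr1n//.
  by rewrite -!mulnn; nia.
have := h k j.
have := ler_normB
  (3 ^+ (k ^ 2) * a - j%:~R + (-1) ^+ z * (3 ^+ (k ^ 2) / 3 ^+ (N ^ 2)))
  ((-1) ^+ z * (3 ^+ (k ^ 2) / 3 ^+ (N ^ 2))).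
rewrite addrK.
move: small; move: (3 ^- N) => u; lra.
Qed.

(** At every scale four times the distance is the absolute value of an odd
    integer minus a multiple of 4. *)
Lemma hair_quarters b (n : nat) : odd n -> b <= 1 -> hair (n%:R / 4) b.
Proof.
move=> on b1 k j; apply: le_trans b1 _.
have -> : 4 * `|3 ^+ (k ^ 2) * (n%:R / 4) - j%:~R| =
    `|(3 ^+ (k ^ 2) * n%:Z - 4 * j)%:~R| :> R.
  rewrite -{1}(ger0_norm (ler0n R 4)) -normrM; congr `|_|.
  by rewrite rmorphB !rmorphM/= rmorphXn/=; field.
rewrite -intr_norm (_ : 1 = 1%:~R)// ler_int -gtz0_ge1 normr_gt0.
apply/eqP => E.
have /(congr1 odd) : `|(3 ^+ (k ^ 2) * n%:Z)%R|%N = `|(4 * j)%R|%N.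
  by congr absz; lia.
by rewrite !abszM abszX /= !oddM oddX on orbT.
Qed.

Lemma on_grid_dense a b : a < b -> exists M t, [/\ on_grid M t, a < t & t < b].
Proof.
move=> ab; have lt13 : 1 < 3 :> R by rewrite ltr1n.
have [|M Mab] := @exists_exprN_lt R 3 (b - a) lt13; first by rewrite subr_gt0.
have p := pow3_gt0 M.
exists M, ((Num.floor (3 ^+ M * a) + 1)%:~R / 3 ^+ M); split.
- by exists (Num.floor (3 ^+ M * a) + 1).
- by rewrite ltr_pdivlMr// mulrC; have /andP[_] := floor_itv (3 ^+ M * a).
have /andP[h _] := floor_itv (3 ^+ M * a).
rewrite ltr_pdivrMr// rmorphD/=.
have : 3 ^- M * 3 ^+ M < (b - a) * 3 ^+ M by rewrite ltr_pM2r.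
by rewrite mulVf ?pow3_neq0//; lra.
Qed.

Local Notation I := (set_type (unit_interval R)).

Definition hairy_map (x : I) : set I :=
  [set y | hairy_rel (set_val x) (set_val y)].

Lemma exists_unit_point t : 0 <= t <= 1 -> exists x : I, set_val x = t.
Proof. by move=> t01; exists (unit_point t01). Qed.

Lemma hairy_map_nonempty (x : I) : hairy_map x !=set0.
Proof.
have /andP[x0 x1] := unit_intervalP x.
have [|y yE] := @exists_unit_point (set_val x / 3); first lra.
by exists y; left.
Qed.

Lemma closed_hairy_rel (X : topologicalType) (f g : X -> R) :
  continuous f -> continuous g -> closed [set x | hairy_rel (f x) (g x)].
Proof.
move=> cf cg.
have c3 : continuous (fun x => f x / 3) by move=> x; apply: cvgMl; exact: cf.
rewrite (_ : mkset _ = ([set x | g x <= f x / 3] `&` [set x | f x / 3 <= g x])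
  `|` ([set x | f x / 3 <= g x] `&` \bigcap_k \bigcap_j
    [set x | g x <= 4 * `|3 ^+ (k ^ 2) * f x - j%:~R|])).
  apply: closedU; first by apply: closedI; exact: closed_le_fun.
  apply: closedI; first exact: closed_le_fun.
  apply: closed_bigI => k _; apply: closed_bigI => j _.
  apply: closed_le_fun => // x; apply: cvgMr; apply: cvg_norm.
  by apply: cvgB; [apply: cvgMr; exact: cf|exact: cvg_cst].
apply/seteqP; split => x /=.
  case=> [->|[h1 h2]]; first by left.
  by right; split => // k _ j _; exact: h2.
case=> [[h1 h2]|[h1 h2]]; first by left; apply/eqP; rewrite eq_le h1.
by right; split => // k j; exact: h2.
Qed.

Lemma hairy_map_compact_valued : compact_valued hairy_map.
Proof.
move=> x; split; first exact: hairy_map_nonempty.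
apply: (subclosed_compact _ (@compact_unit_interval R)) => //.
apply: (@closed_hairy_rel I (cst (set_val x)) set_val).
  exact: cst_continuous.
exact: continuous_set_val.
Qed.

Lemma closed_hairy_graph : closed (graph hairy_map).
Proof.
apply: (@closed_hairy_rel _ (fun p => set_val p.1) (fun p => set_val p.2)) => p.
  by apply: continuous_comp; [exact: cvg_fst|exact: continuous_set_val].
by apply: continuous_comp; [exact: cvg_snd|exact: continuous_set_val].
Qed.

(** The graph is closed and the codomain is compact. *)
Lemma hairy_map_upper_semicontinuous : upper_semicontinuous hairy_map.
Proof.
move=> x U oU xU; exists (interior [set y | hairy_map y `<=` U]); split.
- exact: open_interior.
- have cU : compact (~` U).
    apply: (subclosed_compact _ (@compact_unit_interval R)) => //.
    exact: open_closedC.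
  have clG := closed_openC closed_hairy_graph.
  have : @nbhs I I x [set x' : I | ~` U `<=` [set b : I | ~ hairy_map x' b]].
    have ncU : near_covering (~` U) by apply/compact_near_coveringP.
    apply: (ncU I (@nbhs I I x) (fun (x' b : I) => ~ hairy_map x' b)) => b nUb.
    have nG : (~` graph hairy_map) (x, b) by move=> /xU.
    have [[V W] [/= Vx Wb] VW] := open_nbhs_nbhs (conj clG nG).
    by exists (W, V) => //= -[b' x'] [/= Wb' Vx']; exact: (VW (x', b')).
  by apply: filterS => x' h b xb; apply: contrapT => /h.
- by move=> y /interior_subset.
Qed.

Lemma hairy_map_surjective : surjective_multimap hairy_map.
Proof.
move=> y; have /andP[y0 y1] := unit_intervalP y.
have [y3|y3] := leP (set_val y) (1 / 3).
  have [|x xE] := @exists_unit_point (3 * set_val y); first lra.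
  by exists x; left; rewrite xE; field.
have [|x xE] := @exists_unit_point (1 / 4); first lra.
exists x; right; rewrite xE; split; first lra.
exact: (@hair_quarters _ 1).
Qed.

(** Triadic points are dense, and the only value at such a point t is t / 3. *)
Lemma hairy_map_light : light hairy_map.
Proof.
move=> y; apply/seteqP; split => // x [V [[W oW <-] /= Wx] Vy].
have /andP[x0 x1] := unit_intervalP x.
have : nbhs (set_val x) W by exact: open_nbhs_nbhs.
move=> /nbhs_ballP[d /= d0 dW].
have lt : Num.max 0 (set_val x - d) < Num.min 1 (set_val x + d).
  by rewrite gt_max !lt_min; lra.
have [M1 [t1 [g1 l1 u1]]] := on_grid_dense lt.
have [M2 [t2 [g2 l2 u2]]] := on_grid_dense l1.
have val M t : on_grid M t -> Num.max 0 (set_val x - d) < t ->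
    t < Num.min 1 (set_val x + d) -> set_val y = t / 3.
  rewrite gt_max lt_min => gt /andP[t0 xt] /andP[t1' tx].
  have [|z zE] := @exists_unit_point t; first lra.
  have : hairy_map z y.
    by apply: Vy; apply: dW; rewrite /ball/= zE ltr_norml; lra.
  by move=> /(@hairy_rel_on_grid M); rewrite zE; apply => //; lra.
have := val _ _ g1 l1 u1; rewrite (val _ _ g2 l2 (lt_trans u2 u1)); lra.
Qed.

(** Values between x1 / 3 and x2 / 3 are taken on the line t |-> t / 3. The
    remaining ones lie strictly below the top of a hair, at the right end when
    y1 < y2 and at the left end when y2 < y1, hence on the hair over a nearby
    point of the open interval. *)
Lemma hairy_map_ivp : intermediate_value_property hairy_map.
Proof.
have main (x1 x2 y1 y2 : I) : set_val x1 < set_val x2 ->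
    hairy_map x1 y1 -> hairy_map x2 y2 ->
    forall y, strictly_between (set_val y1) (set_val y) (set_val y2) ->
    exists2 x, set_val x1 < set_val x < set_val x2 & hairy_map x y.
  move=> x12 F1 F2 y by12.
  have /andP[x10 x11] := unit_intervalP x1.
  have /andP[x20 x21] := unit_intervalP x2.
  have y1x := hairy_rel_ge F1; have y2x := hairy_rel_ge F2.
  have lt13 : 1 < 3 :> R by rewrite ltr1n.
  have small (e d : R) : 0 < e -> 0 < d ->
      exists N, [/\ (0 < N)%N, 4 / 3 ^+ N < e & 3 ^- (N ^ 2) < d].
    move=> e0 d0; have ed : 0 < Num.min (e / 4) d by rewrite lt_min d0 divr_gt0.
    have [N] := exists_exprN_lt lt13 ed; rewrite lt_min => /andP[Ne Nd].
    have le (n : nat) : (N <= n)%N -> 3 ^- n <= 3 ^- N :> R.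
      by move=> Nn; rewrite lef_pV2 ?posrE ?pow3_gt0// ler_eXn2l.
    exists N.+1; split => //.
      by have := le N.+1 (leqnSn N); lra.
    apply: le_lt_trans Nd; apply: le; apply: leq_trans (leqnSn N) _.
    by rewrite -mulnn leq_pmulr.
  have d12 : 0 < set_val x2 - set_val x1 by lra.
  case: by12 => /andP[yl yr].
    have [yx|xy] := ltP (set_val y) (set_val x2 / 3).
      have [|x xE] := @exists_unit_point (3 * set_val y); first lra.
      by exists x; [rewrite xE; lra|left; rewrite xE; field].
    have h2 : hair (set_val x2) (set_val y2) by case: F2 => [E|[]//]; lra.
    have e0 : 0 < set_val y2 - set_val y by lra.
    have [N [N0 N1 N2]] := small _ _ e0 d12.
    have := hair_shift true N0 h2; rewrite expr1 mulN1r => h.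
    have p : 0 < 3 ^- (N ^ 2) :> R by rewrite invr_gt0 pow3_gt0.
    have [|x xE] := @exists_unit_point (set_val x2 - 3 ^- (N ^ 2)); first lra.
    exists x; first by rewrite xE; lra.
    by right; rewrite xE; split; [lra|apply: hair_le h; lra].
  have h1 : hair (set_val x1) (set_val y1) by case: F1 => [E|[]//]; lra.
  have e0 : 0 < set_val y1 - set_val y by lra.
  have [N [N0 N1 N2]] := small _ _ e0 d12.
  have := hair_shift false N0 h1; rewrite expr0 mul1r => h.
  have p : 0 < 3 ^- (N ^ 2) :> R by rewrite invr_gt0 pow3_gt0.
  have [|x xE] := @exists_unit_point (set_val x1 + 3 ^- (N ^ 2)); first lra.
  exists x; first by rewrite xE; lra.
  by right; rewrite xE; split; [lra|apply: hair_le h; lra].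
move=> x1 x2 y1 y2 x12 _ F1 F2 y yb.
have [lt|lt|eq] := ltgtP (set_val x1) (set_val x2).
- have [x xb Fx] := main _ _ _ _ lt F1 F2 y yb.
  by exists x => //; left.
- have yb' : strictly_between (set_val y2) (set_val y) (set_val y1).
    by case: yb => ?; [right|left].
  have [x xb Fx] := main _ _ _ _ lt F2 F1 y yb'.
  by exists x => //; right.
- by case: x12; exact: set_val_inj.
Qed.

(** The hair over 1/4 contains 1/4 and 3/4, and 3/4 is mapped to 1/4: stay at
    1/4 and visit 3/4 once in n steps. *)
Lemma hairy_map_periodic n : (0 < n)%N ->
  exists x : nat -> I, multimap_orbit hairy_map x /\ has_period x n.
Proof.
move=> n0; have [|q qE] := @exists_unit_point (1 / 4); first lra.
have [|p pE] := @exists_unit_point (3 / 4); first lra.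
have Fq (y : I) : 1 / 12 <= set_val y -> hairy_map q y.
  move=> y12; right; rewrite qE; split; first lra.
  by apply: (@hair_quarters _ 1) => //; have /andP[] := unit_intervalP y.
have Fp : hairy_map p q by left; rewrite pE qE; field.
have [->|n1] := eqVneq n 1%N.
  exists (fun=> q); split; first by move=> i; apply: Fq; rewrite qE; lra.
  by split.
(* For n = 1 this sequence would stay at 3/4, which is not a fixed point. *)
exists (fun i => if (n %| i)%N then p else q); split.
  move=> i; case: ifPn => ni; last first.
    by apply: Fq; case: ifP; rewrite ?pE ?qE; lra.
  by rewrite ifF// -addn1 dvdn_addr// dvdn1; apply/negbTE.
split => // [i|m m0 /(_ 0%N)]; first by rewrite dvdn_addr.
rewrite addn0 dvdn0; case: ifPn => [/dvdn_leq->//|_ /(congr1 set_val)].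
by rewrite pE qE; lra.
Qed.

Lemma hairy_graph_empty_interior : interior (graph hairy_map) = set0.
Proof.
apply/seteqP; split => // -[x y] [[U V] [/= Ux Vy] UVF].
have : interior [set x | hairy_map x y] x.
  apply: filterS Ux => x' Ux'; apply: (UVF (x', y)); split => //=.
  exact: nbhs_singleton.
by rewrite hairy_map_light.
Qed.

End HairyArc.

(** * Rounding to triadic grids *)

Section Rounding.
Variable R : realType.
Implicit Types (s t : R) (M N i : nat) (v : nat -> R).

Definition round_up M t : R := (Num.ceil (3 ^+ M * t))%:~R / 3 ^+ M.

Lemma round_up_ge M t : t <= round_up M t.
Proof. by rewrite ler_pdivlMr ?pow3_gt0// mulrC ceil_ge. Qed.

Lemma round_up_lt M t : round_up M t < t + 3 ^- M.
Proof.
rewrite ltr_pdivrMr ?pow3_gt0// mulrDl mulVf ?pow3_neq0//.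
by have := ceilB1_lt (3 ^+ M * t); rewrite rmorphB/=; lra.
Qed.

Lemma round_up_on_grid M t : on_grid M (round_up M t).
Proof. by exists (Num.ceil (3 ^+ M * t)). Qed.

Lemma round_up_le M s t : s <= t -> round_up M s <= round_up M t.
Proof.
move=> st; rewrite ler_pM2r ?invr_gt0 ?pow3_gt0// ler_int le_ceil//.
by rewrite ler_pM2l// pow3_gt0.
Qed.

Lemma round_up_id M t : on_grid M t -> round_up M t = t.
Proof.
by move=> [j ->]; rewrite /round_up mulrCA mulfV ?pow3_neq0// mulr1 intrKceil.
Qed.

Lemma on_grid_widen M N t : (M <= N)%N -> on_grid M t -> on_grid N t.
Proof.
move=> MN [j ->]; exists (j * 3 ^+ (N - M)).
rewrite rmorphM rmorphXn/= (_ : 3 ^+ N = 3 ^+ (N - M) * 3 ^+ M); last first.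
  by rewrite -exprD subnK.
by have h := pow3_neq0 R M; have h' := pow3_neq0 R (N - M); field; rewrite h h'.
Qed.

Lemma round_up_round_up M N t : (M <= N)%N ->
  round_up M (round_up N t) = round_up M t.
Proof.
move=> MN; apply/eqP; rewrite eq_le; apply/andP; split; last first.
  exact/round_up_le/round_up_ge.
rewrite -[leRHS](round_up_id (round_up_on_grid M t)); apply: round_up_le.
rewrite -[leRHS](@round_up_id N); first exact/round_up_le/round_up_ge.
exact/(on_grid_widen MN)/round_up_on_grid.
Qed.

Lemma round_up_min M s t :
  round_up M (Num.min s t) = Num.min (round_up M s) (round_up M t).
Proof.
by case: (leP s t) => st; rewrite ?(min_l (round_up_le M st))//
  min_r// round_up_le// ltW.
Qed.

Lemma round_up_near M t : ~ on_grid M t ->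
  \forall t' \near t, round_up M t' = round_up M t.
Proof.
move=> nt; set d := Num.ceil (3 ^+ M * t).
have p := pow3_gt0 R M.
have lo : (d - 1)%:~R / 3 ^+ M < t by rewrite ltr_pdivrMr// mulrC ceilB1_lt.
have hi : t < d%:~R / 3 ^+ M.
  rewrite lt_neqAle round_up_ge andbT; apply/eqP => E.
  by apply: nt; exists d.
apply: filterS2 (lt_nbhsr lo) (lt_nbhsl hi) => t' lo' hi'.
rewrite /round_up -/d; congr (_%:~R / _); apply: ceil_def.
by rewrite mulrC -ltr_pdivrMr// -ler_pdivlMr// lo' ltW.
Qed.

(** Truncation at the height v 0 keeps the height unchanged while the other
    entries move to the grid. *)
Definition round_seq M v : nat -> R :=
  fun i => Num.min (v 0%N) (round_up M (v i)).

Lemma round_seq0 M v : round_seq M v 0 = v 0%N.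
Proof. by rewrite /round_seq min_l// round_up_ge. Qed.

Lemma round_seq_round_seq M N v : (M <= N)%N ->
  round_seq M (round_seq N v) = round_seq M v.
Proof.
move=> MN; apply/funext => i; rewrite /round_seq.
rewrite (min_l (round_up_ge _ _)) round_up_min round_up_round_up// minA.
by rewrite (min_l (round_up_ge _ _)).
Qed.

Lemma round_seq_trunc M v s : round_seq M (fun i => Num.min (v i) s) =
  fun i => Num.min (round_seq M v i) s.
Proof.
apply/funext => i; rewrite /round_seq round_up_min.
by rewrite minACA [Num.min s _]min_l ?round_up_ge.
Qed.

Lemma grid_discrete M s t : on_grid M s -> on_grid M t ->
  `|s - t| < 3 ^- M -> s = t.
Proof.
move=> [j ->] [k ->]; rewrite -mulrBl normrM.
rewrite [X in _ * X]ger0_norm ?invr_ge0 ?ltW ?pow3_gt0//.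
rewrite gtr_pMl ?invr_gt0 ?pow3_gt0// -rmorphB/= -intr_norm.
by rewrite -[X in _ < X]/(1%:~R) ltr_int => h; congr (_%:~R / _); lia.
Qed.

End Rounding.

(** An entry below the height lies on the grid, which is discrete, so it is
    constant as long as it stays below the height; an entry equal to the height
    remains above s. The entries from M on are determined by the height. *)
Lemma grid_locally_constant (R : realType) (X : topologicalType) (A : set X)
    (r : nat -> X -> R) M :
  (forall i q e, A q -> 0 < e ->
    \forall q' \near q, A q' -> `|r i q - r i q'| < e) ->
  (forall i q, A q -> r i q <= r 0%N q) ->
  (forall i q, A q -> r i q < r 0%N q -> on_grid M (r i q)) ->
  (forall i q, A q -> (M <= i)%N -> 0 < r 0%N q ->
    r i q = Num.min (r 0%N q) (3 ^- M)) ->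
  forall q s, A q -> 0 <= s < r 0%N q ->
    \forall q' \near q, A q' ->
      forall i, Num.min (r i q') s = Num.min (r i q) s.
Proof.
move=> rc rle rg rt q s Aq /andP[s0 sq].
have near_gt : \forall q' \near q, A q' -> s < r 0%N q'.
  have e0 : 0 < r 0%N q - s by rewrite subr_gt0.
  apply: filterS (rc 0%N q _ Aq e0) => q' h /h.
  by rewrite ltr_norml; lra.
have finite : \forall q' \near q, forall i, (i < M)%N -> A q' ->
    Num.min (r i q') s = Num.min (r i q) s.
  apply: near_below => i.
  have := rle i q Aq; rewrite le_eqVlt => /orP[/eqP E|lt].
    have e0 : 0 < r i q - s by rewrite E subr_gt0.
    apply: filterS (rc i q _ Aq e0) => q' h Aq'; have := h Aq'.
    by rewrite ltr_norml => /andP[h1 h2]; rewrite !min_r//; lra.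
  have e0 : 0 < (r 0%N q - r i q) / 2 by rewrite divr_gt0// subr_gt0.
  have p : 0 < 3 ^- M :> R by rewrite invr_gt0 pow3_gt0.
  apply: filterS3 (rc i q _ Aq e0) (rc 0%N q _ Aq e0) (rc i q _ Aq p).
  move=> q' h1 h2 h3 Aq'; have {}h1 := h1 Aq'; have {}h2 := h2 Aq'.
  have {}h3 := h3 Aq'; congr Num.min; symmetry.
  apply: (grid_discrete (rg _ _ Aq lt) (rg i q' Aq' _) h3).
  by move: h1 h2; rewrite !ltr_norml; lra.
apply: filterS2 near_gt finite => q' sq' h Aq' i; have {}sq' := sq' Aq'.
have [iM|Mi] := ltnP i M; first exact: h.
rewrite !(rt i)//; try lra.
by case: (leP s (3 ^- M)) => h'; rewrite -!minA [Num.min (3 ^- M) s]minC;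
  rewrite ?(min_l h') ?(min_r (ltW h')) !min_r//; lra.
Qed.

(** * The inverse limit *)

Lemma continuous_of_dist (R : realType) (X : topologicalType) (f : X -> R) :
  (forall x e, 0 < e -> nbhs x [set y | `|f x - f y| < e]) -> continuous f.
Proof. by move=> h x; apply/cvgrPdist_lt => e /(h x). Qed.

Lemma continuous_scale (R : realType) (X : topologicalType) (f : X -> R)
    (a : R) :
  continuous f -> continuous (fun x => f x / a).
Proof. by move=> cf x; apply: cvgMl; exact: cf. Qed.

Lemma continuous_on_subtype (R : realType) (X : topologicalType) (A : set X)
    (f : X -> R) :
  (forall q e, A q -> 0 < e -> \forall q' \near q, A q' -> `|f q - f q'| < e) ->
  continuous (fun z : set_type A => f (set_val z)).
Proof.
move=> h; apply: continuous_of_dist => z e e0.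
apply: (@filterS _ _ (nbhs_filter z) _ _ _
  (@continuous_set_val _ A z _ (h _ _ (set_valP z) e0))).
by move=> z' /(_ (set_valP z')).
Qed.

Section HairyLimit.
Variable R : realType.
Local Notation I := (set_type (unit_interval R)).
Local Notation seqI := (prod_topology (fun _ : nat => I)).
Implicit Types (x q : seqI) (s t e : R) (M N i n : nat).

Definition hairy_limit : set seqI :=
  inverse_limit (T := fun=> set_type (unit_interval R)) (fun=> @hairy_map R).

Local Notation L := hairy_limit.

(** In this scale t |-> t / 3 becomes the identity, so points of the limit
    become nonincreasing sequences, with a drop only where there is a hair. *)
Definition scaled i x : R := set_val (x i) / 3 ^+ i.

Lemma scaledK i x : set_val (x i) = 3 ^+ i * scaled i x.
Proof. by rewrite /scaled mulrC divfK// pow3_neq0. Qed.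

Lemma continuous_val_coord i : continuous (fun x : seqI => set_val (x i)).
Proof.
have ci : continuous (fun x : seqI => x i) :=
  @continuous_prod_coord _ (fun _ : nat => I) i.
by move=> x; exact: (continuous_comp (ci x) (@continuous_set_val _ _ (x i))).
Qed.

Lemma scaled_continuous i : continuous (scaled i).
Proof.
by apply: continuous_scale; exact: continuous_val_coord.
Qed.

Lemma scaled_bound i x : 0 <= scaled i x <= 3 ^- i.
Proof.
have /andP[x0 x1] := unit_intervalP (x i); have p := pow3_gt0 R i.
apply/andP; split; first by rewrite divr_ge0// ltW.
by rewrite /scaled -[leRHS]mul1r ler_pM2r ?invr_gt0.
Qed.

Lemma scaled_rel x i : L x ->
  scaled i.+1 x <= scaled i x /\
  (scaled i x = scaled i.+1 x \/
   hair (3 ^+ i.+1 * scaled i.+1 x) (3 ^+ i * scaled i x)).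
Proof.
move=> /(_ i); rewrite /hairy_map /hairy_rel /= !scaledK.
have p := pow3_gt0 R i; move: (scaled i x) (scaled i.+1 x) => a b.
have -> : 3 ^+ i.+1 * b / 3 = 3 ^+ i * b by rewrite exprS; field.
case=> [/(mulfI (lt0r_neq0 p)) ->|[ba h]]; first by split => //; left.
by split; [rewrite -(ler_pM2l p)|right].
Qed.

Lemma limit_of_scaled x :
  (forall i, scaled i.+1 x <= scaled i x /\
   (scaled i x = scaled i.+1 x \/
    hair (3 ^+ i.+1 * scaled i.+1 x) (3 ^+ i * scaled i x))) -> L x.
Proof.
move=> h i; have := h i; rewrite /hairy_map /hairy_rel /= !scaledK.
have p := pow3_gt0 R i; move: (scaled i x) (scaled i.+1 x) => a b [ba].
have e : 3 ^+ i.+1 * b / 3 = 3 ^+ i * b by rewrite exprS; field.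
case=> [->|hh]; [left|right]; rewrite e//.
by split => //; rewrite ler_pM2l.
Qed.

Lemma scaled_le0 x i : L x -> scaled i x <= scaled 0 x.
Proof.
move=> Lx; elim: i => // i; apply: le_trans.
by have [] := scaled_rel i Lx.
Qed.

(** No hair stands over a triadic point, so the sequence cannot have dropped
    before it reaches a triadic value. *)
Lemma scaled_on_grid x M i : L x -> on_grid M (scaled i x) ->
  scaled i x = scaled 0 x.
Proof.
move=> Lx; elim: i => // i IH g; have [le [E|h]] := scaled_rel i Lx.
  by rewrite -E; apply: IH; rewrite E.
have a0 : 0 <= scaled i.+1 x by have /andP[] := scaled_bound i.+1 x.
have g' : on_grid M (3 ^+ i.+1 * scaled i.+1 x).
  case: g => j ->; exists (3 ^+ i.+1 * j).
  by rewrite rmorphM rmorphXn/= mulrA.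
have := hair_on_grid g' h; rewrite pmulr_rle0 ?pow3_gt0// => le0.
have E : scaled i x = scaled i.+1 x by lra.
by rewrite -E; apply: IH; rewrite E.
Qed.

(** Where truncation changes the entry i + 1 it creates equal entries; elsewhere
    it only shortens the hair that is used. *)
Lemma scaled_trunc x s : L x -> 0 <= s ->
  exists2 y, L y & forall i, scaled i y = Num.min (scaled i x) s.
Proof.
move=> Lx s0.
have val i : exists y : I, set_val y = 3 ^+ i * Num.min (scaled i x) s.
  apply: exists_unit_point; have /andP[b0 b1] := scaled_bound i x.
  have p := pow3_gt0 R i; have p0 := pow3_neq0 R i.
  apply/andP; split; first by rewrite mulr_ge0 ?le_min ?b0 ?s0// ltW.
  apply: (@le_trans _ _ (3 ^+ i * 3 ^- i)); last by rewrite mulfV.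
  by rewrite ler_pM2l// ge_min b1.
have [y yE] := boolp.choice val.
have sy i : scaled i y = Num.min (scaled i x) s.
  by rewrite /scaled yE mulrAC mulfV ?mul1r// pow3_neq0.
exists y => //; apply: limit_of_scaled => i; rewrite !sy.
have [le h] := scaled_rel i Lx; split.
  by rewrite le_min !ge_min le lexx orbT.
case: h => [->|h]; first by left.
have [le'|lt] := leP (scaled i.+1 x) s; last first.
  by left; rewrite !min_r//; lra.
by right; apply: hair_le h; rewrite ler_pM2l ?pow3_gt0// ge_min lexx.
Qed.

Lemma hairy_limit_compact : compact L.
Proof.
have cI : compact [set x : seqI | forall i, [set: I] (x i)].
  exact (@tychonoff nat (fun=> I) (fun=> setT)
    (fun=> @compact_unit_interval R)).
apply: (subclosed_compact _ cI) => //.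
have -> : L = \bigcap_n
    [set x : seqI | hairy_rel (set_val (x n.+1)) (set_val (x n))].
  apply/seteqP; split => x h n //=; last exact: (h n Logic.I).
  by move=> _; exact: h.
apply: closed_bigI => n _.
by apply: closed_hairy_rel; exact: continuous_val_coord.
Qed.

Lemma seqI_hausdorff : hausdorff_space seqI.
Proof.
apply: (@hausdorff_product _ (fun _ : nat => I)) => _.
exact/hausdorff_set_type/Rhausdorff.
Qed.

Lemma hairy_limit_truncation_system : truncation_system L scaled.
Proof.
split.
- exact: seqI_hausdorff.
- exact: hairy_limit_compact.
- exact: scaled_continuous.
- by move=> x i Lx; have /andP[-> _] := scaled_bound i x; exact: scaled_le0.
- by move=> x _; have /andP[_] := scaled_bound 0 x; rewrite expr0 invr1.
- move=> x y _ _ h; apply: functional_extensionality_dep => i.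
  by apply: set_val_inj; rewrite !scaledK h.
- by move=> x s Lx s0; exact: scaled_trunc.
Qed.

Definition rounded M i x : R := round_seq M (fun j => scaled j x) i.

Lemma rounded0 M x : rounded M 0 x = scaled 0 x.
Proof. by rewrite /rounded round_seq0. Qed.

Lemma rounded_le M i x : rounded M i x <= rounded M 0 x.
Proof. by rewrite rounded0 /rounded /round_seq ge_min lexx. Qed.

Lemma rounded_ge0 M i x : 0 <= rounded M i x.
Proof.
have h j : 0 <= scaled j x by have /andP[] := scaled_bound j x.
by rewrite /rounded /round_seq le_min h/= (le_trans (h i))// round_up_ge.
Qed.

Lemma rounded_ge M i x : L x -> scaled i x <= rounded M i x.
Proof.
by move=> Lx; rewrite /rounded /round_seq le_min scaled_le0//= round_up_ge.
Qed.

Lemma rounded_near M i x : L x -> `|rounded M i x - scaled i x| <= 3 ^- M.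
Proof.
move=> Lx; rewrite ger0_norm ?subr_ge0 ?rounded_ge//.
have := round_up_lt M (scaled i x); rewrite /rounded /round_seq.
have : Num.min (scaled 0 x) (round_up M (scaled i x)) <=
    round_up M (scaled i x).
  by rewrite ge_min lexx orbT.
lra.
Qed.

Lemma rounded_trunc M i q q' s :
  (forall j, scaled j q' = Num.min (scaled j q) s) ->
  rounded M i q' = Num.min (rounded M i q) s.
Proof.
by move=> h; rewrite /rounded (funext h) round_seq_trunc.
Qed.

(** Rounding jumps only at grid values. If the entry i is on the grid, it equals
    the height, and nearby the rounded entry is squeezed between the entry and
    the height. *)
Lemma rounded_continuous M i q e : L q -> 0 < e ->
  \forall q' \near q, L q' -> `|rounded M i q - rounded M i q'| < e.
Proof.
move=> Lq e0.
have near0 : \forall q' \near q, `|scaled 0 q - scaled 0 q'| < e.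
  by have /cvgrPdist_lt/(_ _ e0) := @scaled_continuous 0%N q.
have neari : \forall q' \near q, `|scaled i q - scaled i q'| < e.
  by have /cvgrPdist_lt/(_ _ e0) := @scaled_continuous i q.
have [g|ng] := pselect (on_grid M (scaled i q)).
  have qi : rounded M i q = scaled 0 q.
    by rewrite /rounded /round_seq round_up_id// (scaled_on_grid Lq g) minxx.
  apply: filterS2 near0 neari => q' h0 hi Lq'; rewrite qi.
  have := rounded_ge M i Lq'; have := rounded_le M i q'; rewrite rounded0.
  move: h0 hi; rewrite (scaled_on_grid Lq g) !ltr_norml.
  by move: (rounded M i q') => a; lra.
have := @scaled_continuous i q _ (round_up_near ng).
apply: filterS2 near0 => q' h0 E _.
rewrite /rounded /round_seq E; move: h0; apply: le_lt_trans; exact: dist_min_le.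
Qed.

Lemma rounded_on_grid M i q : rounded M i q < rounded M 0 q ->
  on_grid M (rounded M i q).
Proof.
rewrite rounded0 /rounded /round_seq.
case: (leP (scaled 0 q) (round_up M (scaled i q))) => h; first by rewrite ltxx.
by move=> _; exact: round_up_on_grid.
Qed.

(** The entry i is positive and at most 3^(-i), so it is rounded up to the
    smallest positive grid value. *)
Lemma rounded_tail M i q : L q -> (M <= i)%N -> 0 < rounded M 0 q ->
  rounded M i q = Num.min (rounded M 0 q) (3 ^- M).
Proof.
move=> Lq Mi; rewrite !rounded0 => q0.
rewrite /rounded /round_seq; congr Num.min.
have /andP[i0 i1] := scaled_bound i q; have p := pow3_gt0 R M.
have {}i0 : 0 < scaled i q.
  rewrite lt_neqAle i0 andbT eq_sym; apply/eqP => E.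
  have g : on_grid M (scaled i q) by rewrite E; exact: on_grid0.
  by move: q0; rewrite -(scaled_on_grid Lq g) E ltxx.
rewrite /round_up (@ceil_def _ _ 1) ?mul1r//.
rewrite subrr mulr_gt0//= mulrC -ler_pdivlMr// mul1r (le_trans i1)//.
by rewrite lef_pV2 ?posrE ?pow3_gt0// ler_eXn2l// ltr1n.
Qed.

Lemma hairy_limit_tree_approximations : tree_approximations L scaled rounded.
Proof.
split.
- by move=> M i q q' s _ _ _; exact: rounded_trunc.
- exact: rounded_continuous.
- move=> M q s Lq; rewrite -(rounded0 M) => sq.
  apply: (@grid_locally_constant R _ L (fun i x => rounded M i x) M) => //.
  + by move=> *; exact: rounded_continuous.
  + by move=> *; exact: rounded_le.
  + by move=> *; exact: rounded_on_grid.
  + by move=> *; exact: rounded_tail.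
- move=> e e0; have lt13 : 1 < 3 :> R by rewrite ltr1n.
  have [N Ne] := exists_exprN_lt lt13 e0; exists N => M i q NM Lq.
  apply: le_lt_trans (rounded_near M i Lq) _; apply: le_lt_trans Ne.
  by rewrite lef_pV2 ?posrE ?pow3_gt0// ler_eXn2l.
Qed.

Lemma hairy_limit_nontrivial : exists2 x, L x & 0 < scaled 0 x.
Proof.
have [|q qE] := @exists_unit_point R (1 / 4); first lra.
exists (fun=> q); last by rewrite /scaled qE expr0; lra.
move=> n; right; rewrite qE; split; first lra.
by apply: (@hair_quarters _ _ 1) => //; lra.
Qed.

End HairyLimit.

(** * The trees *)

Section HairyTrees.
Variable R : realType.
Local Notation I := (set_type (unit_interval R)).
Local Notation seqR := (prod_topology (fun _ : nat => (R : topologicalType))).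
Local Notation L := (@hairy_limit R).
Implicit Types (s t e : R) (M N i n : nat).

Definition rounded_seq M x : seqR := round_seq M (fun j => scaled j x).

Definition hairy_tree M : set seqR := rounded_seq M @` L.

Local Notation T M := (set_type (hairy_tree M)).

Lemma rounded_seq_in_tree M (z : set_type L) :
  rounded_seq M (set_val z) \in hairy_tree M.
Proof. by rewrite inE; exists (set_val z) => //; exact: set_valP. Qed.

Definition to_tree M (z : set_type L) : T M :=
  exist _ (rounded_seq M (set_val z)) (rounded_seq_in_tree M z).

Lemma seqR_hausdorff : hausdorff_space seqR.
Proof. by apply: hausdorff_product => _; exact: Rhausdorff. Qed.

Lemma tree_hausdorff M : hausdorff_space (T M).
Proof. exact/hausdorff_set_type/seqR_hausdorff. Qed.

Lemma to_tree_continuous M : continuous (to_tree M).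
Proof.
apply: continuous_to_set_type; apply: continuous_to_prod => i.
have key : continuous (fun z : set_type L => rounded M i (set_val z)).
  by apply: continuous_on_subtype => q e; exact: rounded_continuous.
exact: key.
Qed.

Lemma to_tree_surj M (y : T M) : exists z, to_tree M z = y.
Proof.
have [x Lx xy] := set_valP y; exists (exist _ x (mem_set Lx)).
exact: set_val_inj.
Qed.

Lemma limit_compactT : compact [set: set_type L].
Proof. exact/compact_set_typeT/hairy_limit_compact. Qed.

Lemma tree_compactT M : compact [set: T M].
Proof.
have -> : [set: T M] = to_tree M @` setT.
  by apply/seteqP; split => // y _; have [z <-] := to_tree_surj y; exists z.
apply: continuous_compact; last exact: limit_compactT.
exact/continuous_subspaceT/to_tree_continuous.
Qed.

Definition tree_coord M i (y : T M) : R := (set_val y : seqR) i.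

Lemma tree_coord_to_tree M i z :
  tree_coord i (to_tree M z) = rounded M i (set_val z).
Proof. by []. Qed.

Lemma tree_coord_continuous M i : continuous (@tree_coord M i).
Proof.
have ci : continuous (fun y : seqR => y i) :=
  @continuous_prod_coord _ (fun _ : nat => (R : topologicalType)) i.
by move=> y; exact: (continuous_comp (@continuous_set_val _ _ y) (ci _)).
Qed.

Lemma tree_truncation_system M :
  truncation_system [set: T M] (@tree_coord M).
Proof.
split.
- exact: tree_hausdorff.
- exact: tree_compactT.
- exact: tree_coord_continuous.
- move=> y i _; have [z <-] := to_tree_surj y.
  by rewrite !tree_coord_to_tree rounded_ge0 rounded_le.
- move=> y _; have [z <-] := to_tree_surj y.
  rewrite tree_coord_to_tree rounded0.
  by have /andP[_] := scaled_bound 0 (set_val z); rewrite expr0 invr1.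
- by move=> y y' _ _ h; apply: set_val_inj; apply/funext => i; exact: h.
- move=> y s _ s0; have [z <-] := to_tree_surj y.
  have [x Lx xE] := scaled_trunc (set_valP z) s0.
  exists (to_tree M (exist _ x (mem_set Lx))) => // i.
  by rewrite !tree_coord_to_tree; exact: rounded_trunc.
Qed.

Lemma tree_self_approximations M :
  tree_approximations [set: T M] (@tree_coord M) (fun=> @tree_coord M).
Proof.
have cont i (q : T M) e : setT q -> 0 < e ->
    \forall q' \near q, setT q' -> `|tree_coord i q - tree_coord i q'| < e.
  move=> _ e0; have /cvgrPdist_lt/(_ _ e0) := @tree_coord_continuous M i q.
  by apply: filterS.
split.
- by move=> _ i q q' s _ _ _.
- by move=> _; exact: cont.
- move=> _; apply: (@grid_locally_constant _ _ _ (@tree_coord M) M) => //.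
  + by move=> i q _; have [z <-] := to_tree_surj q; exact: rounded_le.
  + by move=> i q _; have [z <-] := to_tree_surj q; exact: rounded_on_grid.
  + move=> i q _; have [z <-] := to_tree_surj q.
    exact/rounded_tail/set_valP.
- by move=> e e0; exists 0%N => _ i q _ _; rewrite subrr normr0.
Qed.

Lemma tree_nontrivial M : exists y : T M, 0 < tree_coord 0 y.
Proof.
have [x Lx x0] := hairy_limit_nontrivial R.
exists (to_tree M (exist _ x (mem_set Lx))).
by rewrite tree_coord_to_tree rounded0.
Qed.

Lemma segment_arc M (y : T M) : 0 < tree_coord 0 y -> exists B,
  Defs.arc R B /\ forall y' : T M, (forall i, tree_coord i y' =
    Num.min (tree_coord i y) (tree_coord 0 y')) -> B y'.
Proof.
move=> y0; have H := tree_truncation_system M.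
set root := trunc [set: T M] (@tree_coord M) y 0.
have root0 : tree_coord 0 root = 0.
  by apply: (trunc_height H); rewrite // lexx ltW.
exists (standard_arc [set: T M] (@tree_coord M) root y); split.
  have [|f [hf _ _]] := standard_arcP H (x := root) (y := y) Logic.I Logic.I.
    by move=> E; move: y0; rewrite -E root0 ltxx.
  by exists f.
move=> y' h; right; exists (tree_coord 0 y'); last first.
  apply: (tr_sep H) => // i; rewrite (truncE H)//.
  exact: (coord_ge0 H 0%N Logic.I).
rewrite /= in_itv/=; apply/andP; split.
  apply: (@le_trans _ _ 0); last exact: (coord_ge0 H 0%N Logic.I).
  have := meet_height_le H (x := root) (y := y) Logic.I Logic.I.
  by rewrite le_min root0 => /andP[].
by rewrite (h 0%N) ge_min lexx.
Qed.

(** By compactness there is a highest point whose coordinates are the truncation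
    of w at its height; all other such points are truncations of it. *)
Lemma word_arc M (w : nat -> R) : exists B, Defs.arc R B /\
  forall y : T M, (forall i, tree_coord i y = Num.min (w i) (tree_coord 0 y)) ->
    B y.
Proof.
have H := tree_truncation_system M.
pose K := [set y : T M |
  forall i, tree_coord i y = Num.min (w i) (tree_coord 0 y)].
have [[y1 [Ky1 y10]]|n] :=
  pselect (exists y, K y /\ 0 < tree_coord 0 y); last first.
  have [y y0] := tree_nontrivial M; have [B [arcB BP]] := segment_arc y0.
  exists B; split => // y' Ky'; apply: BP => i.
  have y'0 : tree_coord 0 y' = 0.
    apply/eqP; rewrite eq_le (coord_ge0 H 0%N Logic.I) andbT leNgt.
    by apply/negP => h; apply: n; exists y'.
  have /andP[a b] := tr_bound H i (Logic.I : [set: T M] y').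
  have c0 := coord_ge0 H i (Logic.I : [set: T M] y).
  by rewrite y'0 (min_r c0); apply/eqP; rewrite eq_le a -{1}y'0 b.
have clK : closed K.
  rewrite (_ : K = \bigcap_i
    ([set y | tree_coord i y <= Num.min (w i) (tree_coord 0 y)] `&`
     [set y : T M | Num.min (w i) (tree_coord 0 y) <= tree_coord i y])).
    apply: closed_bigI => i _.
    have cm : continuous (fun y : T M => Num.min (w i) (tree_coord 0 y)).
      apply: continuous_min_fun; first exact: cst_continuous.
      exact: tree_coord_continuous.
    by apply: closedI; apply: closed_le_fun => //; exact: tree_coord_continuous.
  apply/seteqP; split=> y h i /=; first by move=> _; rewrite -(h i).
  by have [h1 h2] := h i Logic.I; apply/eqP; rewrite eq_le; apply/andP.
have cK : compact K by apply: (subclosed_compact clK (@tree_compactT M)).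
have [||y] := @compact_EVT_max _ R (@tree_coord M 0%N) K _ cK.
- by exists y1.
- exact/continuous_subspaceT/tree_coord_continuous.
rewrite inE => Ky ymax.
have y0 : 0 < tree_coord 0 y.
  by apply: lt_le_trans y10 _; apply: ymax; rewrite inE.
have [B [arcB BP]] := segment_arc y0.
exists B; split => // y' Ky'; apply: BP => i.
have le : tree_coord 0 y' <= tree_coord 0 y by apply: ymax; rewrite inE.
by rewrite (Ky i) -minA (min_r le); exact: Ky'.
Qed.

(** Before truncation at the height there are only finitely many rounded
    sequences. *)
Lemma rounded_word M x : L x -> 0 < scaled 0 x ->
  exists f : {ffun 'I_M -> 'I_(3 ^ M).+1}, forall i, rounded M i x =
    Num.min (if insub i is Some j then (f j : nat)%:R / 3 ^+ M else 3 ^- M)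
      (scaled 0 x).
Proof.
move=> Lx x0; have p := pow3_gt0 R M.
have key (i : 'I_M) : exists k : 'I_(3 ^ M).+1,
    round_up M (scaled i x) = (k : nat)%:R / 3 ^+ M.
  have /andP[b0 b1] := scaled_bound i x.
  have c0 : 0 <= Num.ceil (3 ^+ M * scaled i x).
    by rewrite ceil_ge0 (lt_le_trans (ltrN10 R))// mulr_ge0// ltW.
  have le : (`|Num.ceil (3 ^+ M * scaled i x)| < (3 ^ M).+1)%N.
    rewrite ltnS -lez_nat gez0_abs// ceil_le_int -[leRHS]/((3 ^ M)%:R) natrX.
    rewrite -[leRHS]mulr1 ler_pM2l// (le_trans b1)// invf_le1 ?pow3_gt0//.
    exact: pow3_ge1.
  exists (Ordinal le); rewrite /round_up /=; congr (_ / _).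
  by rewrite -{1}(gez0_abs c0).
have [f fE] := boolp.choice key.
exists [ffun i => f i] => i; rewrite /rounded /round_seq minC.
case: insubP => [j _ ji|ni].
  by rewrite ffunE -fE ji.
have Mi : (M <= i)%N by rewrite leqNgt.
have := @rounded_tail R M i x Lx Mi; rewrite rounded0 => /(_ x0).
by rewrite /rounded /round_seq minC => ->; exact: minC.
Qed.

Lemma tree_is_tree M : tree R [set: T M].
Proof.
have H := tree_truncation_system M.
split.
- apply: (truncation_system_continuum H).
  by have [y _] := tree_nontrivial M; exists y.
- exact: tree_approximations_uniquely_arcwise_connected H
    (tree_self_approximations M).
pose word (f : {ffun 'I_M -> 'I_(3 ^ M).+1}) (i : nat) : R :=
  if insub i is Some j then (f j : nat)%:R / 3 ^+ M else 3 ^- M.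
have [B BP] := boolp.choice (fun f => word_arc M (word f)).
pose W := {ffun 'I_M -> 'I_(3 ^ M).+1}.
exists #|W|; exists (fun i : 'I_#|W| => B (enum_val i)); split.
  by move=> i; have [] := BP (enum_val i).
apply/seteqP; split => // y _; have [z yz] := to_tree_surj y.
have [f fE] : exists f, forall i,
    tree_coord i y = Num.min (word f i) (tree_coord 0 y).
  have Lz := set_valP z.
  have [z0|z0] := ltP 0 (scaled 0 (set_val z)).
    have [f fE] := rounded_word M Lz z0; exists f => i.
    by rewrite -yz !tree_coord_to_tree rounded0 fE.
  exists [ffun=> ord0] => i.
  have c0 : tree_coord 0 y = 0.
    apply/eqP; rewrite eq_le (coord_ge0 H 0%N Logic.I) andbT.
    by rewrite -yz tree_coord_to_tree rounded0.
  have /andP[a b] := tr_bound H i (Logic.I : [set: T M] y).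
  rewrite c0 min_r; first by apply/eqP; rewrite eq_le a -{1}c0 b.
  rewrite /word; case: insubP => [j _ _|_]; first by rewrite ffunE mul0r.
  by rewrite invr_ge0 ltW// pow3_gt0.
exists (enum_rank f) => //=; rewrite enum_rankK; exact: (proj2 (BP f)).
Qed.

Lemma bonding_in_tree n (y : T n.+1) :
  round_seq n (set_val y : seqR) \in hairy_tree n.
Proof.
have [z <-] := to_tree_surj y; rewrite inE.
exists (set_val z); first exact: set_valP.
by rewrite /= /rounded_seq round_seq_round_seq.
Qed.

Definition bonding n (y : T n.+1) : T n :=
  exist _ (round_seq n (set_val y : seqR) : seqR) (bonding_in_tree y).

Lemma bonding_to_tree n z : bonding (to_tree n.+1 z) = to_tree n z.
Proof. apply: set_val_inj; exact: (round_seq_round_seq _ (leqnSn n)). Qed.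

Lemma bonding_continuous n : continuous (@bonding n).
Proof.
apply: (@continuous_of_compact_quotient (set_type L) (T n.+1) (T n)
  (to_tree n.+1) (@bonding n)).
- exact: limit_compactT.
- exact: tree_hausdorff.
- exact: to_tree_continuous.
- exact: to_tree_surj.
- have -> : @bonding n \o to_tree n.+1 = to_tree n.
    by apply/funext => z; exact: bonding_to_tree.
  exact: to_tree_continuous.
Qed.

Local Notation treeT := (fun n => (T n : topologicalType)).
Local Notation limT :=
  (inverse_limit (T := treeT) (fun n x => [set bonding x])).

Lemma to_trees_coherent (z : set_type L) :
  ((fun n => to_tree n z) : prod_topology treeT) \in limT.
Proof. by rewrite inE => n; rewrite /= bonding_to_tree. Qed.

Definition to_trees (z : set_type L) : set_type limT :=
  exist _ ((fun n => to_tree n z) : prod_topology treeT) (to_trees_coherent z).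

Lemma to_trees_inj : injective to_trees.
Proof.
move=> z z' E; apply: set_val_inj.
apply: (tr_sep (hairy_limit_truncation_system R)); [exact: set_valP..|move=> i].
have app M : rounded M i (set_val z) = rounded M i (set_val z').
  have /(congr1 (fun f : prod_topology treeT => f M)) := congr1 set_val E.
  by move=> /(congr1 (@tree_coord M i)).
apply/eqP; rewrite -subr_eq0 -normr_eq0 eq_le normr_ge0 andbT leNgt.
apply/negP => d0; have lt13 : 1 < 3 :> R by rewrite ltr1n.
have d2 : 0 < `|scaled i (set_val z) - scaled i (set_val z')| / 2.
  by rewrite divr_gt0.
have [M MP] := exists_exprN_lt lt13 d2.
have h1 := rounded_near M i (set_valP z).
have h2 := rounded_near M i (set_valP z').
move: h1 h2 MP; rewrite app distrC => h1 h2.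
have := ler_normD (scaled i (set_val z) - rounded M i (set_val z'))
  (rounded M i (set_val z') - scaled i (set_val z')).
have -> : scaled i (set_val z) - rounded M i (set_val z') +
  (rounded M i (set_val z') - scaled i (set_val z')) =
  scaled i (set_val z) - scaled i (set_val z') by ring.
lra.
Qed.

(** A limit point of preimages at the finite levels maps to the given coherent
    sequence. *)
Lemma to_trees_surj (y : set_type limT) : exists z, to_trees z = y.
Proof.
have coh n : set_val y n = bonding (set_val y n.+1) by exact: (set_valP y n).
have [u uE] := boolp.choice (fun n => to_tree_surj (set_val y n)).
have down n k : to_tree k (u (k + n)%N) = set_val y k.
  elim: n k => [|n IH] k; first by rewrite addn0.
  by rewrite coh -(IH k.+1) bonding_to_tree addSnnS.
have [z [_ uz]] := @limit_compactT (u @ \oo) _ filterT.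
exists z; apply: set_val_inj; apply: functional_extensionality_dep => k.
apply: (@tree_hausdorff k) => U V Uz Vy.
have Uz' := @to_tree_continuous k z _ Uz.
have [|w [[n nk <-] Uw]] := uz (u @` [set n | (k <= n)%N]) _ _ Uz'.
  by exists k => // n /= kn; exists n.
exists (to_tree k (u n)); split => //.
rewrite -(subnKC nk) down; exact: nbhs_singleton.
Qed.

Lemma hairy_limit_tree_like : tree_like R L.
Proof.
exists treeT, (@bonding); split.
- exact: tree_is_tree.
- exact: bonding_continuous.
exists to_trees; apply: compact_hausdorff_homeomorphism.
- exact: limit_compactT.
- apply: hausdorff_set_type; apply: (@hausdorff_product _ treeT) => n.
  exact: tree_hausdorff.
- apply: continuous_to_set_type; apply: continuous_to_prod => n.
  exact: to_tree_continuous.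
- exact: to_trees_inj.
- exact: to_trees_surj.
Qed.

End HairyTrees.

Theorem theorem1p2 (R : realType) :
  exists F : unit_interval R -> set (unit_interval R),
    compact_valued F /\
    upper_semicontinuous F /\
    surjective_multimap F /\
    light F /\
    intermediate_value_property F /\
    (forall n : nat, (0 < n)%N ->
       exists x : nat -> unit_interval R, multimap_orbit F x /\ has_period x n) /\
    interior (graph F) = set0 /\
    let L := inverse_limit (T := fun=> set_type (unit_interval R)) (fun=> F) in
    continuum R L /\
    arcwise_connected R L /\
    hereditarily_decomposable R L /\
    tree_like R L.
Proof.
have H := hairy_limit_truncation_system R.
exists (@hairy_map R); split; first exact: hairy_map_compact_valued.
split; first exact: hairy_map_upper_semicontinuous.
split; first exact: hairy_map_surjective.
split; first exact: hairy_map_light.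
split; first exact: hairy_map_ivp.
split; first exact: hairy_map_periodic.
split; first exact: hairy_graph_empty_interior.
split.
  apply: (truncation_system_continuum H).
  by have [x Lx _] := hairy_limit_nontrivial R; exists x.
split; first exact: truncation_system_arcwise_connected H.
split; last exact: hairy_limit_tree_like.
exact: tree_approximations_hereditarily_decomposable H
  (hairy_limit_tree_approximations R).
Qed.
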